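(* Every minimal isometric immersion of an irrational flat $3$-torus into a sphere is homogeneous.
   Context: A flat $3$-torus is $\mathbb{R}^3/\Lambda_3$ with $\Lambda_3$ a lattice of rank $3$; let $(q_{ij})$ be the Gram matrix of $\Lambda_3$ (matrix of inner products of a basis) and let $K$ be the extension of $\mathbb{Q}$ generated by all ratios $q_{ij}/q_{11}$. The torus is irrational if $[K:\mathbb{Q}]>1$. Spheres are unit round spheres. Homogeneity: choose coordinates so that $T^3=\mathbb{R}^3/\Lambda_3$ has metric $\frac{4\pi^2}{3}(du_1^2+du_2^2+du_3^2)$. Let $\Lambda_3^*=\{\xi:\langle\xi,v\rangle\in\mathbb{Z}\ \forall v\in\Lambda_3\}$ and let $\pm\xi_1,\dots,\pm\xi_N$ be all vectors of length $1$ in $\Lambda_3^*$. Put $\theta_r=2\pi\langle\xi_r,u\rangle$, $\Theta_r=(\cos\theta_r,\sin\theta_r)$. Every minimal isometric immersion $x:T^3\to\mathbb{S}^m$ has the form $x=(\Theta_1,\dots,\Theta_N)A$ for a unique real $2N\times(m+1)$ matrix $A$; $x$ is homogeneous if and only if $AA^t$ is diagonal, equivalently, up to an isometry of the sphere, $x=(\sqrt{a_1}e^{\mathrm{i}\theta_1},\dots,\sqrt{a_N}e^{\mathrm{i}\theta_N})$ with $a_r\ge0$. *)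

(* Defs.v *)
From mathcomp Require Import all_boot all_order all_algebra.
From mathcomp Require Import all_classical all_reals all_analysis.

Set Implicit Arguments.
Unset Strict Implicit.
Unset Printing Implicit Defensive.

Import Order.TTheory GRing.Theory Num.Theory.
Import numFieldNormedType.Exports.

Local Open Scope classical_set_scope.
Local Open Scope ring_scope.

(* Euclidean inner product of row vectors.  The library norm on 'rV[R]_n is the
   sup norm; it is used here only through the topology it induces. *)
Definition dot (R : realType) (n : nat) (u v : 'rV[R]_n) : R :=
  (u *m v^T) 0 0.

(* The lattice spanned over Z by the rows of B; it has rank 3 exactly when
   B \in unitmx. *)
Definition lattice (R : realType) (B : 'M[R]_3) : set 'rV[R]_3 :=
  [set l | exists k : 'rV[int]_3, l = map_mx intr k *m B].

Definition gram (R : realType) (B : 'M[R]_3) : 'M[R]_3 :=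
  \matrix_(i, j) dot (row i B) (row j B).

Definition gen_subfield (R : realType) (A : set R) : set R :=
  [set a | forall S : {pred R},
     divring_closed S -> (forall b, A b -> b \in S) -> a \in S].

Definition rat_independent (R : realType) (n : nat) (a : 'I_n -> R) : Prop :=
  forall c : 'I_n -> rat, \sum_i ratr (c i) * a i = 0 -> forall i, c i = 0.

(* [K : Q] > n, where the degree may be infinite. *)
Definition degree_gt (R : realType) (K : set R) (n : nat) : Prop :=
  exists2 a : 'I_n.+1 -> R, (forall i, K (a i)) & rat_independent a.

Definition gram_field (R : realType) (B : 'M[R]_3) : set R :=
  gen_subfield [set a | exists i j, a = gram B i j / gram B 0 0].

Definition irrational_torus (R : realType) (B : 'M[R]_3) : Prop :=
  degree_gt (gram_field B) 1%N.

Fixpoint class_C (R : realType) (n m : nat) (k : nat)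
    (f : 'rV[R]_n.+1 -> 'rV[R]_m.+1) : Prop :=
  match k with
  | 0%N => continuous f
  | k'.+1 => (forall p, differentiable f p) /\ (forall v, class_C k' ('D_v f))
  end.

Definition smooth (R : realType) (n m : nat)
    (f : 'rV[R]_n.+1 -> 'rV[R]_m.+1) : Prop :=
  forall k, class_C k f.

(* A map R^3/Lambda -> S^m is represented by its Lambda-periodic lift
   R^3 -> R^(m+1), with Lambda the lattice of B.  Preservation of the metric
   makes the differential injective, so that x is an immersion. *)
Record isometric_immersion (R : realType) (m : nat) (B : 'M[R]_3)
    (x : 'rV[R]_3 -> 'rV[R]_m.+1) : Prop := IsometricImmersion {
  immersion_periodic : forall l, lattice B l -> forall p, x (p + l) = x p;
  immersion_smooth : smooth x;
  immersion_sphere : forall p, dot (x p) (x p) = 1;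
  immersion_isometric : forall p u v, dot ('D_u x p) ('D_v x p) = dot u v }.

Definition frame (R : realType) (i : 'I_3) : 'rV[R]_3 := delta_mx 0 i.

(* Component of y normal to x inside the sphere: for x isometric into the unit
   sphere, x p and the 'D_(frame i) x p are orthonormal, and they span the
   radial line plus the tangent space of x at p. *)
Definition normal_part (R : realType) (m : nat)
    (x : 'rV[R]_3 -> 'rV[R]_m.+1) (p : 'rV[R]_3) (y : 'rV[R]_m.+1) :
    'rV[R]_m.+1 :=
  y - dot y (x p) *: x p
    - \sum_i dot y ('D_(frame R i) x p) *: 'D_(frame R i) x p.

(* II(u, v) in the sphere: u and v extend to constant, hence parallel, fields
   on the flat torus, and the flat connection of R^(m+1) differs from that of
   the sphere by a radial term, which normal_part removes. *)
Definition second_fundamental_form (R : realType) (m : nat)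
    (x : 'rV[R]_3 -> 'rV[R]_m.+1) (p u v : 'rV[R]_3) : 'rV[R]_m.+1 :=
  normal_part x p ('D_u ('D_v x) p).

Definition mean_curvature (R : realType) (m : nat)
    (x : 'rV[R]_3 -> 'rV[R]_m.+1) (p : 'rV[R]_3) : 'rV[R]_m.+1 :=
  3^-1 *: \sum_i second_fundamental_form x p (frame R i) (frame R i).

Definition minimal (R : realType) (m : nat)
    (x : 'rV[R]_3 -> 'rV[R]_m.+1) : Prop :=
  forall p, mean_curvature x p = 0.

(* Every translation of the torus is induced by an isometry of the sphere, that
   is, by an orthogonal matrix.  The matrices g arising in this way form a
   subgroup of O(m+1), and the image of x is an orbit of it.
   When x = (Theta_1, ..., Theta_N) A, with Theta_r = (cos theta_r, sin theta_r),
   this invariance says that A A^t commutes with all the simultaneous rotations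
   of the Theta_r by the angles theta_r(v).  As the frequencies +-xi_r are
   distinct and x has unit length, it amounts to A A^t being diagonal. *)
Definition homogeneous (R : realType) (m : nat)
    (x : 'rV[R]_3 -> 'rV[R]_m.+1) : Prop :=
  forall v, exists2 g : 'M[R]_m.+1,
    g *m g^T = 1%:M & forall u, x (u + v) = x u *m g.

(* Main.v *)
(* Minimality means that x is an eigenfunction of the Laplacian, so
   x(u) = sum_k c_k e^(i <eta_k, u>) over the finitely many dual lattice vectors
   eta_k with |eta_k|^2 = 3.  Comparing Fourier coefficients in |x|^2 = 1 and in
   the isometry condition gives, for h(k) = c_k . c_(kap - k) and om = eta_kap:
     sum_k h(k) = [kap = 0],
     sum_k h(k) <eta_k, v> <eta_(kap - k), w> = - [kap = 0] <v, w>.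
   The map x is homogeneous as soon as h = 0 for all kap <> 0, since then
   <x(u + v), x(u' + v)> does not depend on v.

   Irrationality makes the linear system |eta_k|^2 = 3, with the Gram matrix as
   unknown, degenerate over Q: a nonzero rational quadratic form X vanishes at all
   the eta_k, and the relations with kap = 0 force X to be trace free.  Let om <> 0
   and write eta_k = om / 2 + tau_k.  On the support of h the vectors tau_k lie on
   a circle in the plane orthogonal to om, are X-orthogonal to om, and X takes one
   value on them.  If X is not a multiple of the metric on that plane, this leaves
   at most two pairs +-tau_k, and the relations above give h = 0.  Otherwise X is a
   multiple of <., om>^2 - 4/3 |.|^2 with |om|^2 = 4; evaluating X on the lattice,
   where it is rational, then shows that the metric itself is rational. *)
Require Import Defs.
From mathcomp Require Import all_boot all_order all_algebra.
From mathcomp Require Import all_classical all_reals all_analysis.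
From mathcomp Require Import complex zify ring lra.

Set Implicit Arguments.
Unset Strict Implicit.
Unset Printing Implicit Defensive.

Import Order.TTheory GRing.Theory Num.Theory.
Import numFieldNormedType.Exports.

Local Open Scope classical_set_scope.
Local Open Scope ring_scope.

(** * Integration over the unit interval *)

(** Of Fourier theory only uniqueness is needed: a $C^1$ function on the torus all of whose
    coefficients vanish is zero. An eigenfunction has coefficients only at the finitely many dual
    vectors of one length, and subtracting the corresponding finite sum leaves a function without
    coefficients, so no question of convergence arises. Uniqueness is reduced to one real variable
    by averaging along one basis vector of the lattice at a time, and there to a statement about
    cosine moments. The symmetry of second derivatives, on which $\Delta x = -3x$ rests, is obtained
    from uniqueness as well.

    At the other end, homogeneity is read off inner products alone: once $\langle x(s+v),
    x(t+v)\rangle = \langle x(s), x(t)\rangle$ for all $s, t$, the two families of points have the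
    same Gram data, and a product of reflections carries one to the other. *)

Section ContinuousOperations.
Variables (R : realType) (T : topologicalType).
Implicit Types f g : T -> R.

Lemma continuous_add f g :
  continuous f -> continuous g -> continuous (fun s => f s + g s).
Proof. by move=> cf cg s; apply: cvgD; [exact: cf|exact: cg]. Qed.

Lemma continuous_mul f g :
  continuous f -> continuous g -> continuous (fun s => f s * g s).
Proof. by move=> cf cg s; apply: cvgM; [exact: cf|exact: cg]. Qed.

Lemma continuous_sum I (r : seq I) (F : I -> T -> R) :
  (forall i, continuous (F i)) -> continuous (fun s => \sum_(i <- r) F i s).
Proof.
move=> cF; elim: r => [|i r IH].
  by under eq_fun do rewrite big_nil; exact: cst_continuous.
by under eq_fun do rewrite big_cons; exact: continuous_add.
Qed.

Lemma continuous_scale c f : continuous f -> continuous (fun s => c * f s).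
Proof. by move=> cf; apply: continuous_mul => //; exact: cst_continuous. Qed.

Lemma continuous_opp f : continuous f -> continuous (fun s => - f s).
Proof. by move=> cf s; apply: cvgN; exact: cf. Qed.

Lemma continuous_exprn f n : continuous f -> continuous (fun s => f s ^+ n).
Proof.
move=> cf s; apply: (@continuous_comp _ _ _ f (fun x => x ^+ n)).
  exact: cf.
exact: exprn_continuous.
Qed.

Lemma continuous_cos_comp f : continuous f -> continuous (fun s => cos (f s)).
Proof.
by move=> cf s; apply: continuous_comp; [exact: cf|exact: continuous_cos].
Qed.

Lemma continuous_sin_comp f : continuous f -> continuous (fun s => sin (f s)).
Proof.
by move=> cf s; apply: continuous_comp; [exact: cf|exact: continuous_sin].
Qed.

End ContinuousOperations.

Section UnitIntervalMean.
Variable R : realType.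
Implicit Types f g : R -> R.

Definition mean01 g : R := (\int[lebesgue_measure]_(s in `[0, 1]) g s)%R.

Lemma integrable01 g : continuous g ->
  lebesgue_measure.-integrable `[0, 1] (EFin \o g).
Proof.
move=> cg; apply: continuous_compact_integrable; first exact: segment_compact.
exact: continuous_subspaceT.
Qed.

Lemma mean01D f g : continuous f -> continuous g ->
  mean01 (fun s => f s + g s) = mean01 f + mean01 g.
Proof. by move=> cf cg; apply: RintegralD => //; exact: integrable01. Qed.

Lemma mean01Z c g : continuous g -> mean01 (fun s => c * g s) = c * mean01 g.
Proof. by move=> cg; apply: RintegralZl => //; exact: integrable01. Qed.

Lemma mean01B f g : continuous f -> continuous g ->
  mean01 (fun s => f s - g s) = mean01 f - mean01 g.
Proof.
move=> cf cg; rewrite mean01D //; last exact: continuous_opp.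
rewrite -[in RHS]mulN1r -mean01Z //; congr (_ + mean01 _).
by apply/funext => s; rewrite mulN1r.
Qed.

Lemma mean01_cst c : mean01 (fun=> c) = c.
Proof.
rewrite /mean01 Rintegral_cst //.
rewrite [X in fine X]lebesgue_measure_itv /= lte_fin ltr01.
by rewrite -EFinB /= subr0 mulr1.
Qed.

Lemma le_mean01 f g : continuous f -> continuous g ->
  (forall s, 0 <= s <= 1 -> f s <= g s) -> mean01 f <= mean01 g.
Proof.
move=> cf cg fg; by apply: le_Rintegral => //; exact: integrable01.
Qed.

Lemma mean01_FTC (F f : R -> R) :
  continuous f -> (forall s, is_derive s (1 : R) F (f s)) ->
  mean01 f = F 1 - F 0.
Proof.
move=> cf dF; rewrite /mean01 /Rintegral (@continuous_FTC2 _ f F) //.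
- exact: continuous_subspaceT.
- have cF : continuous F.
    by move=> s; apply/differentiable_continuous/derivable1_diffP; case: (dF s).
  split => [s _||]; first by case: (dF s).
  + by apply: cvg_at_right_filter; exact: cF.
  + by apply: cvg_at_left_filter; exact: cF.
- by move=> s _; rewrite derive1E; exact: derive_val.
Qed.

Lemma norm_mean01_le g C : continuous g ->
  (forall s, 0 <= s <= 1 -> `|g s| <= C) -> `|mean01 g| <= C.
Proof.
move=> cg gC; rewrite ler_norml -[- C]mean01_cst -[X in _ && (_ <= X)]mean01_cst.
apply/andP; split; apply: le_mean01 => //; try exact: cst_continuous;
  by move=> s /gC; rewrite ler_norml => /andP[].
Qed.

Lemma mean01_gt0 g : continuous g -> (forall s, 0 <= s <= 1 -> 0 <= g s) ->
  0 < g (1 / 2) -> 0 < mean01 g.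
Proof.
move=> cg g0 gh.
have ch := cg (1 / 2).
have /cvgrPdist_lt/(_ (g (1 / 2) / 2)) := ch.
have e0 : 0 < g (1 / 2) / 2 by rewrite divr_gt0.
move=> /(_ e0) /nbhs_ballP[d /= d0 hd].
(* The halving puts the closed interval of radius [r] around 1/2 inside both the ball of radius [d]
   and [0, 1]. *)
pose r := Num.min d (1 / 2) / 2.
have r0 : 0 < r by rewrite /r divr_gt0 // lt_min d0 divr_gt0.
have [rd rh] : r < d /\ r < 1 / 2.
  have m0 : 0 < Num.min d (1 / 2) by rewrite lt_min d0 divr_gt0.
  have := lexx (Num.min d (1 / 2)); rewrite [X in _ <= X -> _]/= le_min => /andP[md mh].
  by rewrite /r; split; lra.
pose a := 1 / 2 - r; pose b := 1 / 2 + r.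
have sub : `[a, b] `<=` `[0, 1].
  by move=> s; rewrite /= !in_itv /= /a /b => /andP[? ?]; apply/andP; split; lra.
apply: (@lt_le_trans _ _ (\int[lebesgue_measure]_(s in `[a, b]) (g (1 / 2) / 2))%R).
  rewrite Rintegral_cst // [X in fine X]lebesgue_measure_itv /= lte_fin.
  have -> : a < b by rewrite /a /b; lra.
  by rewrite /= mulr_gt0 // /a /b; lra.
apply: (@le_trans _ _ (\int[lebesgue_measure]_(s in `[a, b]) g s)%R).
  apply: le_Rintegral => //.
  - apply: continuous_compact_integrable; first exact: segment_compact.
    by apply: continuous_subspaceT; exact: cst_continuous.
  - apply: continuous_compact_integrable; first exact: segment_compact.
    exact: continuous_subspaceT.
  move=> s; rewrite /= in_itv /= /a /b => /andP[s1 s2].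
  have : ball (1 / 2 : R) d s by rewrite /ball /= ltr_norml; apply/andP; split; lra.
  by move=> /hd /=; rewrite ltr_norml => /andP[_]; lra.
rewrite /mean01 /Rintegral fine_le //.
- apply: integrable_fin_num => //.
  apply: continuous_compact_integrable; first exact: segment_compact.
  exact: continuous_subspaceT.
- by apply: integrable_fin_num => //; exact: integrable01.
- apply: ge0_subset_integral => //.
  exact: measurable_int (integrable01 cg).
Qed.

End UnitIntervalMean.

(** * Continuous functions on [0, 1] without cosine moments *)

Section CosineMoments.
Variable R : realType.

Lemma bernoulli_le (q : R) n : 0 <= q -> 1 + n%:R * (q - 1) <= q ^+ n.
Proof.
move=> q0; elim: n => [|n IH]; first by rewrite mul0r addr0 expr0.
have := ler_wpM2l q0 IH; rewrite -exprS; apply: le_trans.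
rewrite -natr1 -subr_ge0.
have -> : q * (1 + n%:R * (q - 1)) - (1 + (n%:R + 1) * (q - 1))
  = n%:R * (q - 1) ^+ 2 by ring.
by rewrite mulr_ge0 // sqr_ge0.
Qed.

Definition cosk (k : int) (s : R) := cos (2 * pi * k%:~R * s).

Lemma cosk_continuous k : continuous (cosk k).
Proof.
by apply: continuous_cos_comp; apply: continuous_scale => ?; exact: cvg_id.
Qed.

Lemma cosk_mul k s :
  cosk 1 s * cosk k s = 2^-1 * cosk (k + 1) s + 2^-1 * cosk (k - 1) s.
Proof.
rewrite /cosk !rmorphD /= rmorphN1 mulr1z mulr1.
have -> : 2 * pi * (k%:~R + 1) * s = 2 * pi * k%:~R * s + 2 * pi * s by ring.
have -> : 2 * pi * (k%:~R - 1) * s = 2 * pi * k%:~R * s - 2 * pi * s by ring.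
by rewrite cosB cosD; field.
Qed.

(** By the product formula, multiplication by [cosk 1] only shifts the index [k] by one in both
    directions, so the vanishing of all moments survives each factor [al + be * cosk 1]. *)
Lemma cos_moments_pow (g : R -> R) (al be : R) : continuous g ->
  (forall k, mean01 (fun s => g s * cosk k s) = 0) ->
  forall n k, mean01 (fun s => g s * (al + be * cosk 1 s) ^+ n * cosk k s) = 0.
Proof.
move=> cg g0; elim=> [|n IH] k.
  rewrite -[RHS](g0 k); congr mean01; apply/funext => s.
  by rewrite expr0 mulr1.
have cn k' : continuous (fun s => g s * (al + be * cosk 1 s) ^+ n * cosk k' s).
  apply: continuous_mul; last exact: cosk_continuous.
  apply: continuous_mul => //; apply: continuous_exprn.
  apply: continuous_add; first exact: cst_continuous.
  exact/continuous_scale/cosk_continuous.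
have cZ c k' :
    continuous (fun s => c * (g s * (al + be * cosk 1 s) ^+ n * cosk k' s)).
  exact: continuous_scale.
rewrite (_ : (fun s => _) = fun s =>
  al * (g s * (al + be * cosk 1 s) ^+ n * cosk k s) +
  (be / 2 * (g s * (al + be * cosk 1 s) ^+ n * cosk (k + 1) s) +
   be / 2 * (g s * (al + be * cosk 1 s) ^+ n * cosk (k - 1) s))).
  rewrite mean01D //; last by apply: continuous_add.
  by rewrite mean01D // !mean01Z // !IH !mulr0 !addr0.
apply/funext => s; have := cosk_mul k s; rewrite exprS.
move: (cosk 1 s) (cosk k s) (cosk (k + 1) s) (cosk (k - 1) s) => c1 c c' c'' E.
transitivity (al * (g s * (al + be * c1) ^+ n * c) +
  be * g s * (al + be * c1) ^+ n * (c1 * c)); first by ring.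
by rewrite E; field.
Qed.

(* The powers of q = 1 + (- cos (2 pi s) - kap) / 2 concentrate at s = 1/2: by
   Bernoulli, g q^n >= c n (q - 1)^+ - C, whose mean is unbounded in n. *)
Lemma cos_moments_le0 (g : R -> R) : continuous g ->
  (forall k, mean01 (fun s => g s * cosk k s) = 0) -> g (1 / 2) <= 0.
Proof.
move=> cg g0; rewrite leNgt; apply/negP => gh.
have [C C0 gC] : exists2 C : R, 0 <= C & forall s : R, 0 <= s <= 1 -> `|g s| <= C.
  have cn : {within `[0, 1], continuous (fun s => `|g s|)}.
    apply: continuous_subspaceT => s.
    by apply: continuous_comp; [exact: cg|exact: (@norm_continuous _ R^o)].
  have [c _ gc] := EVT_max ler01 cn.
  by exists `|g c|; [exact: normr_ge0|move=> s s01; apply: gc; rewrite in_itv].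
pose c := g (1 / 2) / 2.
have c0 : 0 < c by rewrite divr_gt0.
have [d [d0 d4 gd]] : exists d : R,
    [/\ 0 < d, d <= 1 / 4 & forall s : R, `|s - 1 / 2| < d -> c < g s].
  have /cvgrPdist_lt/(_ _ c0) /nbhs_ballP[d /= d0 hd] := cg (1 / 2).
  exists (Num.min d (1 / 4)); split; first by rewrite lt_min d0 divr_gt0.
    by rewrite ge_min lexx orbT.
  move=> s; rewrite lt_min => /andP[sd _].
  have /hd /= : ball (1 / 2 : R) d s by rewrite /ball /= distrC.
  by rewrite ltr_norml => /andP[_]; rewrite /c; lra.
(* With this threshold, [q] exceeds 1 on [0, 1] exactly where |s - 1/2| < d, because cosine
   decreases on [0, pi]. The factor 1/2 in [q] keeps it nonnegative, as Bernoulli's inequality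
   requires. *)
pose kap := cos (2 * pi * d).
pose q (s : R) : R := (1 - kap / 2) + (- 2^-1) * cosk 1 s.
have pi0 := pi_gt0 R.
have cosE s : cosk 1 s = - cos (2 * pi * `|s - 1 / 2|).
  rewrite /cosk mulr1.
  have -> : cos (2 * pi * `|s - 1 / 2|) = cos (2 * pi * (s - 1 / 2)).
    by rewrite -[RHS]cos_norm normrM [`|2 * pi|]ger0_norm // mulr_ge0 // ltW.
  rewrite (_ : 2 * pi * (s - 1 / 2) = 2 * pi * s - pi); last by field.
  by rewrite cosB cospi sinpi; ring.
have qE s : q s = 1 + (cos (2 * pi * `|s - 1 / 2|) - kap) / 2.
  by rewrite /q cosE; field.
have q0 s : 0 <= q s.
  rewrite qE; have := cos_geN1 (2 * pi * `|s - 1 / 2|).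
  by have := cos_le1 (2 * pi * d); rewrite -/kap; lra.
have dpi : 2 * pi * d \in `[0, pi].
  rewrite in_itv /= mulr_ge0 ?mulr_ge0 ?ltW //=.
  by have := ler_wpM2l (ltW pi0) d4; lra.
have spi (s : R) : 0 <= s <= 1 -> 2 * pi * `|s - 1 / 2| \in `[0, pi].
  move=> /andP[s0 s1]; rewrite in_itv /=.
  rewrite mulr_ge0 ?normr_ge0 ?mulr_ge0 ?pi_ge0 //=.
  have h : `|s - 1 / 2| <= 1 / 2 by rewrite ler_norml; apply/andP; split; lra.
  by have := ler_wpM2l (ltW pi0) h; lra.
have q_in (s : R) : 0 <= s <= 1 -> `|s - 1 / 2| < d -> 1 < q s.
  move=> s01 sd; rewrite qE ltrDl divr_gt0 // subr_gt0 /kap ltr_cos //.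
    by rewrite ltr_pM2l // mulr_gt0.
  exact: spi.
have q_out (s : R) : 0 <= s <= 1 -> d <= `|s - 1 / 2| -> q s <= 1.
  move=> s01 sd; rewrite qE gerDl pmulr_lle0 ?invr_gt0 // subr_le0 /kap leNgt.
  rewrite ltr_cos //; last exact: spi.
  by rewrite -leNgt ler_pM2l // mulr_gt0.
have cq : continuous q.
  apply: continuous_add; first exact: cst_continuous.
  exact/continuous_scale/cosk_continuous.
pose r (s : R) : R := Num.max (q s - 1) 0.
have cr : continuous r.
  have cq1 : continuous (fun s => q s - 1).
    by apply: continuous_add => //; exact: cst_continuous.
  move=> s; apply: (@continuous_max _ _ (fun s => q s - 1) (fun=> 0)).
    exact: cq1.
  exact: cst_continuous.
have r0 : 0 < mean01 r.
  apply: mean01_gt0 => // [s _|]; first by rewrite le_max lexx orbT.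
  rewrite lt_max subr_gt0 q_in ?subrr ?normr0 //.
  by apply/andP; split; lra.
have key n : c * n%:R * mean01 r <= C.
  have cL : continuous (fun s => c * n%:R * r s).
    exact: continuous_scale.
  have cN : continuous (fun s => g s * q s ^+ n).
    by apply: continuous_mul => //; exact: continuous_exprn.
  rewrite -mean01Z // -subr_le0.
  have -> : 0 = mean01 (fun s => g s * q s ^+ n).
    rewrite -(cos_moments_pow (1 - kap / 2) (- 2^-1) cg g0 n 0).
    by congr mean01; apply/funext => s; rewrite /cosk mulr0 mul0r cos0 mulr1.
  rewrite -[C]mean01_cst -mulN1r -mean01Z; last exact: cst_continuous.
  rewrite -mean01D //; last by move=> s; exact: cst_continuous.
  apply: le_mean01 => //.
    by apply: continuous_add => //; exact: cst_continuous.
  move=> s s01; rewrite mulN1r lerBlDr.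
  have [sd|sd] := ltP `|s - 1 / 2| d.
    have q1 := q_in _ s01 sd.
    rewrite /r max_l; last by rewrite subr_ge0 ltW.
        apply: (@le_trans _ _ (g s * q s ^+ n)); last by rewrite lerDl.
    rewrite -mulrA; apply: ler_pM; rewrite ?(ltW c0) //.
    - by rewrite mulr_ge0 // subr_ge0 ltW.
    - exact/ltW/gd.
    - by have := bernoulli_le n (q0 s); apply: le_trans; rewrite lerDr.
  have q1 := q_out _ s01 sd.
  rewrite /r max_r ?subr_le0 // mulr0 -lerBlDr sub0r.
  have : `|g s * q s ^+ n| <= C.
    rewrite normrM [`|q s ^+ n|]ger0_norm ?exprn_ge0 //.
    apply: (@le_trans _ _ `|g s|); last exact: gC.
    by rewrite ler_piMr // exprn_ile1.
  by rewrite ler_norml => /andP[].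
have m0 : 0 < c * mean01 r by rewrite mulr_gt0.
pose n := (Num.bound (C / (c * mean01 r))).
have : C / (c * mean01 r) < n%:R.
  by apply: archi_boundP; rewrite divr_ge0 // ltW.
rewrite ltr_pdivrMr // => Cn; have := key n.
by rewrite leNgt => /negP; apply; rewrite mulrAC mulrC.
Qed.

(** Every [cosk k] is symmetric about 1/2, so a function antisymmetric about 1/2 has no cosine
    moments. Hence only the value at the centre can be recovered; other points are reached by moving
    the base point of the segment. *)
Lemma cos_moments_eq0 (g : R -> R) : continuous g ->
  (forall k, mean01 (fun s => g s * cosk k s) = 0) -> g (1 / 2) = 0.
Proof.
move=> cg g0; apply/eqP; rewrite eq_le cos_moments_le0 //=.
rewrite -oppr_le0; apply: (@cos_moments_le0 (fun s => - g s)) => [|k].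
  exact: continuous_opp.
rewrite (_ : (fun s => _) = fun s => -1 * (g s * cosk k s)).
  rewrite mean01Z ?g0 ?mulr0 //.
  by apply: continuous_mul => //; exact: cosk_continuous.
by apply/funext => s; rewrite mulN1r mulNr.
Qed.

End CosineMoments.

(** * Directional derivatives *)

Section DirectionalCalculus.
Variables (R : realType) (V : normedModType R).
Implicit Types (f g : V -> R) (u v b : V).

(** A class $C^k$ that mentions directional derivatives only. It follows from [class_C] for the
    coordinates of a map, and it passes through integrals along segments without any estimate on
    full differentials. *)
Fixpoint dC (k : nat) f : Prop :=
  continuous f /\
  match k with
  | 0%N => True
  | k'.+1 => (forall p v, derivable f p v) /\ forall v, dC k' ('D_v f)
  end.

Lemma dC_continuous k f : dC k f -> continuous f.
Proof. by case: k => [|k] []. Qed.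

Lemma dC_derivable k f p v : dC k.+1 f -> derivable f p v.
Proof. by move=> [_ [+ _]]; apply. Qed.

Lemma dC_derive k f v : dC k.+1 f -> dC k ('D_v f).
Proof. by move=> [_ [_]]; apply. Qed.

Lemma dCW k f : dC k.+1 f -> dC k f.
Proof.
elim: k f => [|k IH] f; first by case.
by move=> [cf [df Df]]; split=> //; split=> // v; apply/IH/Df.
Qed.

Lemma is_derive_line f u v (s : R) : derivable f (u + s *: v) v ->
  is_derive s (1 : R) (fun t => f (u + t *: v)) ('D_v f (u + s *: v)).
Proof.
move=> df.
have E : (fun h => h^-1 *: (((fun t => f (u + t *: v)) \o shift s) (h *: (1 : R))
           - f (u + s *: v))) =
         (fun h => h^-1 *: ((f \o shift (u + s *: v)) (h *: v) - f (u + s *: v))).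
  apply/funext => h /=; congr (_ *: (f _ - _)).
  by rewrite [h *: 1]mulr1 scalerDl addrCA.
by apply: DeriveDef; rewrite /derivable /derive E.
Qed.

Lemma MVT_line f u v (h : R) : (forall p, derivable f p v) ->
  exists2 c, `|c| <= `|h| & f (u + h *: v) - f u = 'D_v f (u + c *: v) * h.
Proof.
move=> df.
have dg s := is_derive_line (df (u + s *: v)).
have cg : continuous (fun t : R => f (u + t *: v)).
  by move=> s; apply/differentiable_continuous/derivable1_diffP; case: (dg s).
have [h0|h0] := leP 0 h.
  have [c] := MVT_segment h0 (fun s _ => dg s) (continuous_subspaceT cg).
  rewrite in_itv /= => /andP[c0 ch]; rewrite scale0r addr0 subr0 => E.
  by exists c => //; rewrite !ger0_norm.
have [c] := MVT_segment (ltW h0) (fun s _ => dg s) (continuous_subspaceT cg).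
rewrite in_itv /= => /andP[hc c0]; rewrite scale0r addr0 sub0r => E.
exists c; first by rewrite !ler0_norm ?lerN2 // ltW.
by rewrite -opprB E mulrN opprK.
Qed.

(** When [b] is a period of [f], this is the projection of [f] to the functions constant along
    [b]. *)
Definition mean_along b f u : R := mean01 (fun s => f (u + s *: b)).

Lemma continuous_line f b u : continuous f -> continuous (fun s : R => f (u + s *: b)).
Proof.
move=> cf s; apply: (@continuous_comp _ _ _ (fun s : R => u + s *: b) f).
  apply: cvgD; first exact: cst_continuous.
  by apply: cvgZr_tmp; exact: cvg_id.
exact: cf.
Qed.

(** Tube lemma: continuity at each point of the compact segment gives one neighbourhood of [u] that
    serves all [s] in [0, 1]. *)
Lemma near_segment f b u (e : R) : continuous f -> 0 < e ->
  \forall w \near u, forall s : R, 0 <= s <= 1 ->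
    `|f (w + s *: b) - f (u + s *: b)| < e.
Proof.
move=> cf e0.
have e20 : 0 < e / 2 by rewrite divr_gt0.
have := (@compact_near_coveringP R `[(0 : R), 1]%classic).1
  (@segment_compact R 0 1) V (nbhs u)
  (fun w s => `|f (w + s *: b) - f (u + s *: b)| < e) _.
have H : forall x : R, 0 <= x <= 1 -> \forall x' \near x & i \near nbhs u,
    `|f (i + x' *: b) - f (u + x' *: b)| < e.
  move=> s _.
  have cF : {for (s, u), continuous (fun z : R * V => f (z.2 + z.1 *: b))}.
    apply: (@continuous_comp _ _ _ (fun z : R * V => z.2 + z.1 *: b) f).
      apply: cvgD; first exact: cvg_snd.
      by apply: cvgZr_tmp; exact: cvg_fst.
    exact: cf.
  have /cvgrPdist_lt/(_ _ e20) h1 := cF.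
  have /cvgrPdist_lt/(_ _ e20) h2 := @continuous_line f b u cf s.
  have h2' : \forall z \near (s, u),
      `|f (u + s *: b) - f (u + z.1 *: b)| < e / 2.
    by apply: (@cvg_fst _ _ (nbhs s) (nbhs u) _ _ h2).
  near=> z => /=.
  have /= k1 : `|f (u + s *: b) - f (z.2 + z.1 *: b)| < e / 2 by near: z.
  have k2 : `|f (u + s *: b) - f (u + z.1 *: b)| < e / 2 by near: z.
  rewrite -(subrKA (f (u + s *: b))) [e]splitr.
  by apply: le_lt_trans (ler_normD _ _) _; rewrite ltrD // distrC.
move=> /(_ _ H); apply: filter_app; near=> w => + s s01; apply.
by rewrite /= in_itv.
Unshelve. all: by end_near. Qed.

Lemma mean_along_continuous b f : continuous f -> continuous (mean_along b f).
Proof.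
move=> cf u; apply/cvgrPdist_le => e e0.
have := @near_segment f b u e cf e0; apply: filter_app; near=> w => H.
rewrite /mean_along -mean01B; [|exact: continuous_line..].
apply: norm_mean01_le; last by move=> s /H /ltW; rewrite distrC.
by apply: continuous_add; [|apply: continuous_opp]; exact: continuous_line.
Unshelve. all: by end_near. Qed.

(** Differentiation under the integral. By the mean value theorem the difference quotient at [s] is
    ['D_v f] at an intermediate point; that point depends on [s], but its parameter is at most [h]
    in absolute value, and [near_segment] applied to ['D_v f] is uniform in [s]. *)
Lemma is_derive_mean_along b f u v : continuous f ->
  (forall p, derivable f p v) -> continuous ('D_v f) ->
  is_derive u v (mean_along b f) (mean_along b ('D_v f) u).
Proof.
move=> cf df cD.
suff H : (fun h => h^-1 *: ((mean_along b f \o shift u) (h *: v) - mean_along b f u))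
    @ 0^' --> mean_along b ('D_v f) u.
  apply: DeriveDef; first by apply/cvg_ex; eexists; exact: H.
  exact/cvg_lim.
apply/cvgrPdist_le => e e0.
have hs : \forall t \near (0 : R), forall s : R, 0 <= s <= 1 ->
    `|'D_v f (u + t *: v + s *: b) - 'D_v f (u + s *: b)| < e.
  have c0 : (fun t : R => u + t *: v) @ nbhs 0 --> u.
    rewrite -[X in _ --> X]addr0 -(scale0r v).
    apply: cvgD; first exact: cvg_cst.
    by apply: cvgZr_tmp; exact: cvg_id.
  by have := c0 _ (@near_segment _ b u e cD e0).
have /nbhs_ballP[r /= r0 hr] := hs.
near=> h.
have h0 : h != 0 by near: h; exact: nbhs_dnbhs_neq.
have hlt : `|h| < r by near: h; exact: dnbhs0_lt.
rewrite /= /mean_along -[h^-1 *: _]/(h^-1 * _).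
have cQ : continuous (fun s : R => f (h *: v + u + s *: b) - f (u + s *: b)).
  by apply: continuous_add; [|apply: continuous_opp]; exact: continuous_line.
rewrite -mean01B; [|exact: continuous_line..].
rewrite -mean01Z // -mean01B;
  [|exact: (@continuous_line _ b u cD)|exact: continuous_scale cQ].
apply: norm_mean01_le.
  apply: continuous_add; first exact: (@continuous_line _ b u cD).
  exact: continuous_opp (continuous_scale cQ).
move=> s s01.
have [c ch E] := MVT_line (u + s *: b) h df.
rewrite -addrA [h *: v + _]addrC E mulrCA mulVf // mulr1.
have /hr /(_ s s01) /ltW : ball (0 : R) r c.
  by rewrite /ball /= sub0r normrN (le_lt_trans ch).
by rewrite distrC addrAC.
Unshelve. all: by end_near. Qed.

Lemma mean_along_derive k b f v u : dC k.+1 f ->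
  'D_v (mean_along b f) u = mean_along b ('D_v f) u.
Proof.
move=> [cf [df Df]].
by have [_] := @is_derive_mean_along b f u v cf (df^~ v) (dC_continuous (Df v)).
Qed.

Lemma mean_along_dC k b f : dC k f -> dC k (mean_along b f).
Proof.
elim: k f => [|k IH] f; first by case=> cf _; split=> //; exact: mean_along_continuous.
move=> Hf; have [cf [df Df]] := Hf.
split; first exact: mean_along_continuous.
split=> [p v|v].
  by case: (@is_derive_mean_along b f p v cf (df^~ v) (dC_continuous (Df v))).
have -> : 'D_v (mean_along b f) = mean_along b ('D_v f).
  by apply/funext => u; exact: mean_along_derive Hf.
exact/IH/Df.
Qed.

Lemma mean_along_self b f u : dC 1 f ->
  mean_along b ('D_b f) u = f (u + b) - f u.
Proof.
move=> [cf [df Df]]; rewrite /mean_along.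
have cD : continuous (fun s : R => 'D_b f (u + s *: b)).
  have cDb : continuous ('D_b f) by case: (Df b).
  exact: (@continuous_line _ b u cDb).
have := mean01_FTC cD (fun s => is_derive_line (df (u + s *: b) b)).
by rewrite scale1r scale0r addr0.
Qed.

Lemma derive0_line_cst f v : (forall p, derivable f p v) ->
  (forall p, 'D_v f p = 0) -> forall u a, f (u + a *: v) = f u.
Proof.
move=> df D0 u a; have [c _ E] := MVT_line u a df.
by apply/eqP; rewrite -subr_eq0 E D0 mul0r.
Qed.

(** The derivative of the mean along [b] is the mean of ['D_b f], which is [f (u + b) - f u] by the
    fundamental theorem, hence zero. *)
Lemma mean_along_invariant b f u a : dC 1 f -> (forall p, f (p + b) = f p) ->
  mean_along b f (u + a *: b) = mean_along b f u.
Proof.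
move=> Hf per; apply: derive0_line_cst.
  by move=> p; apply: dC_derivable (mean_along_dC b Hf).
by move=> p; rewrite (mean_along_derive _ _ _ Hf) mean_along_self // per subrr.
Qed.

End DirectionalCalculus.

Section ClassClosure.
Variables (R : realType) (V : normedModType R).
Implicit Types (f g : V -> R) (v : V).

Lemma dC_ext k f g : f =1 g -> dC k f -> dC k g.
Proof. by move=> /funext ->. Qed.

Lemma dC_cst k (c : R) : dC k (fun _ : V => c).
Proof.
elim: k c => [|k IH] c; first by split=> //; exact: cst_continuous.
split; first exact: cst_continuous.
split=> [p v|v]; first exact: derivable_cst.
by apply: dC_ext (IH 0) => p; rewrite (derive_cst c).
Qed.

Lemma dC_add k f g : dC k f -> dC k g -> dC k (fun u => f u + g u).
Proof.
elim: k f g => [|k IH] f g Hf Hg.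
  by split=> //; apply: continuous_add; [case: Hf|case: Hg].
split; first by apply: continuous_add; [case: Hf|case: Hg].
split=> [p v|v].
  by apply: derivableD; [apply: dC_derivable Hf|apply: dC_derivable Hg].
apply: dC_ext (IH _ _ (dC_derive v Hf) (dC_derive v Hg)) => p.
by rewrite -deriveD //; [apply: dC_derivable Hf|apply: dC_derivable Hg].
Qed.

Lemma deriveME f g u v : derivable f u v -> derivable g u v ->
  'D_v (fun u => f u * g u) u = 'D_v f u * g u + f u * 'D_v g u.
Proof.
move=> df dg; have := deriveM df dg => ->.
by rewrite addrC mulrC; congr (_ + _); rewrite mulrC.
Qed.

Lemma dC_mul k f g : dC k f -> dC k g -> dC k (fun u => f u * g u).
Proof.
elim: k f g => [|k IH] f g Hf Hg.
  by split=> //; apply: continuous_mul; [case: Hf|case: Hg].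
split; first by apply: continuous_mul; [case: Hf|case: Hg].
split=> [p v|v].
  by apply: derivableM; [apply: dC_derivable Hf|apply: dC_derivable Hg].
have H1 := IH _ _ (dC_derive v Hf) (dCW Hg).
have H2 := IH _ _ (dCW Hf) (dC_derive v Hg).
apply: dC_ext (dC_add H1 H2) => p.
by rewrite deriveME //; [apply: dC_derivable Hf|apply: dC_derivable Hg].
Qed.

Lemma dC_scale k (c : R) f : dC k f -> dC k (fun u => c * f u).
Proof. by apply: dC_mul; exact: dC_cst. Qed.

Lemma dC_opp k f : dC k f -> dC k (fun u => - f u).
Proof.
by move=> /(dC_scale (-1)); apply: dC_ext => u; rewrite mulN1r.
Qed.

Lemma dC_sub k f g : dC k f -> dC k g -> dC k (fun u => f u - g u).
Proof. by move=> Hf Hg; apply: dC_add => //; exact: dC_opp. Qed.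

End ClassClosure.

Section Phases.
Variables (R : realType) (n : nat).
Implicit Types (w u v : 'rV[R]_n.+1).

Lemma dotE m (u v : 'rV[R]_m) : dot u v = \sum_i u 0 i * v 0 i.
Proof. by rewrite /dot mxE; apply: eq_bigr => i _; rewrite mxE. Qed.

Lemma dotC m (u v : 'rV[R]_m) : dot u v = dot v u.
Proof. by rewrite !dotE; apply: eq_bigr => i _; rewrite mulrC. Qed.

Lemma dotDl m (u v w : 'rV[R]_m) : dot (u + v) w = dot u w + dot v w.
Proof. by rewrite /dot mulmxDl mxE. Qed.

Lemma dotDr m (u v w : 'rV[R]_m) : dot w (u + v) = dot w u + dot w v.
Proof. by rewrite dotC dotDl !(dotC w). Qed.

Lemma dotZl m c (u v : 'rV[R]_m) : dot (c *: u) v = c * dot u v.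
Proof. by rewrite /dot -scalemxAl mxE. Qed.

Lemma dotZr m c (u v : 'rV[R]_m) : dot u (c *: v) = c * dot u v.
Proof. by rewrite dotC dotZl dotC. Qed.

Lemma dotNl m (u v : 'rV[R]_m) : dot (- u) v = - dot u v.
Proof. by rewrite -scaleN1r dotZl mulN1r. Qed.

Lemma dotBl m (u v w : 'rV[R]_m) : dot (u - v) w = dot u w - dot v w.
Proof. by rewrite dotDl dotNl. Qed.

Lemma dotBr m (u v w : 'rV[R]_m) : dot w (u - v) = dot w u - dot w v.
Proof. by rewrite dotC dotBl !(dotC w). Qed.

Lemma dot0l m (u : 'rV[R]_m) : dot 0 u = 0.
Proof. by rewrite /dot mul0mx mxE. Qed.

Lemma dot_suml m I (r : seq I) (F : I -> 'rV[R]_m) (v : 'rV[R]_m) :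
  dot (\sum_(i <- r) F i) v = \sum_(i <- r) dot (F i) v.
Proof. by rewrite /dot mulmx_suml summxE. Qed.

Lemma dot_eq0 m (u : 'rV[R]_m) : (dot u u == 0) = (u == 0).
Proof.
apply/eqP/eqP => [|->]; last by rewrite dot0l.
rewrite dotE => /eqP.
rewrite psumr_eq0 => [/allP h|i _]; last by rewrite -expr2 sqr_ge0.
apply/rowP => i; rewrite mxE; apply/eqP.
by have := h i (mem_index_enum _); rewrite /= mulf_eq0 orbb.
Qed.

Lemma dot_continuous w : continuous (dot w).
Proof.
have -> : dot w = fun u => \sum_i w 0 i * u 0 i by apply/funext => u; rewrite dotE.
apply: continuous_sum => i; apply: continuous_scale.
exact: coord_continuous.
Qed.

Lemma is_derive_dot_comp (g dg : R -> R) w u v :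
  (forall s, is_derive s (1 : R) g (dg s)) ->
  is_derive u v (fun p => g (dot w p)) (dg (dot w u) * dot w v).
Proof.
move=> Hg.
pose h t : R := dot w u + t * dot w v.
have Hh : is_derive (0 : R) (1 : R) h (dot w v).
  have -> : h = cst (dot w u) + dot w v \*: id.
    by apply/funext => t; rewrite /h mulrC.
  apply: is_derive_eq; rewrite add0r; exact: mulr1.
have Hg' : is_derive (h 0) (1 : R) g (dg (dot w u)).
  by rewrite /h mul0r addr0.
have [D E] := is_derive1_comp Hg' Hh.
have E' : (fun t => t^-1 *: (((fun p => g (dot w p)) \o shift u) (t *: v)
             - g (dot w u))) =
          (fun t => t^-1 *: ((g \o h \o shift 0) (t *: (1 : R)) - (g \o h) 0)).
  apply/funext => t /=.
  by rewrite /h mul0r !addr0 [t *: 1]mulr1 dotDr dotZr [_ + dot w u]addrC.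
apply: DeriveDef; first by rewrite /derivable E'.
by rewrite /derive E'.
Qed.

(** Cosine and sine are treated together because differentiation along [v] maps the coefficients
    [(c, s)] to [(s * dot w v, - c * dot w v)], so the family is closed and the induction goes
    through. *)
Lemma dC_phase k w (c s : R) :
  dC k (fun u => c * cos (dot w u) + s * sin (dot w u)).
Proof.
have cont c' s' : continuous (fun u => c' * cos (dot w u) + s' * sin (dot w u)).
  apply: continuous_add; apply: continuous_scale;
    [apply: continuous_cos_comp|apply: continuous_sin_comp];
    exact: dot_continuous.
have D c' s' p v : is_derive p v
    (fun u => c' * cos (dot w u) + s' * sin (dot w u))
    ((s' * dot w v) * cos (dot w p) + (- c' * dot w v) * sin (dot w p)).
  have Hc := @is_derive_dot_comp cos (fun s => - sin s) w p v (@is_derive_cos R).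
  have Hs := @is_derive_dot_comp sin cos w p v (@is_derive_sin R).
  have := is_deriveD (is_deriveZ c' Hc) (is_deriveZ s' Hs).
  by move=> H; apply: is_derive_eq; rewrite /GRing.scale /=; ring.
elim: k c s => [|k IH] c s; first by split=> //; exact: cont.
split; first exact: cont.
split=> [p v|v]; first by case: (D c s p v).
by apply: dC_ext (IH (s * dot w v) (- c * dot w v)) => p; case: (D c s p v).
Qed.

End Phases.

(** * Complex-valued functions of a real vector *)

Section ComplexFunctions.
Variables (R : realType) (V : normedModType R).
Local Notation C := R[i].
Local Notation cre := (@complex.Re R).
Local Notation cim := (@complex.Im R).
Implicit Types (F G : V -> C) (b u v : V) (z : C).

Lemma complex_ext (z z' : C) : cre z = cre z' -> cim z = cim z' -> z = z'.
Proof. by case: z z' => [a c] [a' c'] /= -> ->. Qed.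

Lemma creD (z z' : C) : cre (z + z') = cre z + cre z'.
Proof. by case: z z' => [a c] [a' c']. Qed.

Lemma cimD (z z' : C) : cim (z + z') = cim z + cim z'.
Proof. by case: z z' => [a c] [a' c']. Qed.

Lemma creM (z z' : C) : cre (z * z') = cre z * cre z' - cim z * cim z'.
Proof. by case: z z' => [a c] [a' c']. Qed.

Lemma cimM (z z' : C) : cim (z * z') = cre z * cim z' + cim z * cre z'.
Proof. by case: z z' => [a c] [a' c']. Qed.

(** Real and imaginary parts are kept apart so that all the calculus stays over the real field. *)
Definition cdC k F := dC k (cre \o F) /\ dC k (cim \o F).

Definition cderive v F u : C :=
  ('D_v (cre \o F) u +i* 'D_v (cim \o F) u)%C.

Definition cmean b F u : C :=
  (mean_along b (cre \o F) u +i* mean_along b (cim \o F) u)%C.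

Lemma cdC_cst k z : cdC k (fun _ : V => z).
Proof. by split; exact: dC_cst. Qed.

Lemma cdC_add k F G : cdC k F -> cdC k G -> cdC k (fun u => F u + G u).
Proof.
move=> [F1 F2] [G1 G2]; split.
  by apply: dC_ext (dC_add F1 G1) => u /=; rewrite creD.
by apply: dC_ext (dC_add F2 G2) => u /=; rewrite cimD.
Qed.

Lemma cdC_mul k F G : cdC k F -> cdC k G -> cdC k (fun u => F u * G u).
Proof.
move=> [F1 F2] [G1 G2]; split.
  by apply: dC_ext (dC_sub (dC_mul F1 G1) (dC_mul F2 G2)) => u /=; rewrite creM.
by apply: dC_ext (dC_add (dC_mul F1 G2) (dC_mul F2 G1)) => u /=; rewrite cimM.
Qed.

Lemma cdC_sum k I (r : seq I) (F : I -> V -> C) :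
  (forall i, cdC k (F i)) -> cdC k (fun u => \sum_(i <- r) F i u).
Proof.
move=> HF; elim: r => [|i r IH].
  by under eq_fun do rewrite big_nil; exact: cdC_cst.
by under eq_fun do rewrite big_cons; exact: cdC_add.
Qed.

Lemma cdCW k F : cdC k.+1 F -> cdC k F.
Proof. by move=> [F1 F2]; split; exact: dCW. Qed.

Lemma cdC_derive k F v : cdC k.+1 F -> cdC k (cderive v F).
Proof. by move=> [F1 F2]; split; exact: (dC_derive v). Qed.

Lemma cderiveD F G u v : cdC 1 F -> cdC 1 G ->
  cderive v (fun u => F u + G u) u = cderive v F u + cderive v G u.
Proof.
move=> [F1 F2] [G1 G2]; apply: complex_ext; rewrite ?creD ?cimD /=.
  rewrite -deriveD; [|exact: dC_derivable F1|exact: dC_derivable G1].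
  by congr ('D_v _ u); apply/funext => p /=; rewrite creD.
rewrite -deriveD; [|exact: dC_derivable F2|exact: dC_derivable G2].
by congr ('D_v _ u); apply/funext => p /=; rewrite cimD.
Qed.

Lemma cderiveM F G u v : cdC 1 F -> cdC 1 G ->
  cderive v (fun u => F u * G u) u = cderive v F u * G u + F u * cderive v G u.
Proof.
move=> [F1 F2] [G1 G2]; apply: complex_ext; rewrite ?creD ?cimD ?creM ?cimM /=.
  transitivity ('D_v (fun u => (cre \o F) u * (cre \o G) u -
                               (cim \o F) u * (cim \o G) u) u).
    by congr ('D_v _ u); apply/funext => p /=; rewrite creM.
  have := @deriveB _ _ _ (fun u => (cre \o F) u * (cre \o G) u)
    (fun u => (cim \o F) u * (cim \o G) u) u v => ->.
  - rewrite !deriveME /=; first by ring.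
    + exact: dC_derivable F2.
    + exact: dC_derivable G2.
    + exact: dC_derivable F1.
    + exact: dC_derivable G1.
  - exact: dC_derivable (dC_mul F1 G1).
  - exact: dC_derivable (dC_mul F2 G2).
transitivity ('D_v (fun u => (cre \o F) u * (cim \o G) u +
                             (cim \o F) u * (cre \o G) u) u).
  by congr ('D_v _ u); apply/funext => p /=; rewrite cimM.
have := @deriveD _ _ _ (fun u => (cre \o F) u * (cim \o G) u)
  (fun u => (cim \o F) u * (cre \o G) u) u v => ->.
- rewrite !deriveME /=; first by ring.
  + exact: dC_derivable F2.
  + exact: dC_derivable G1.
  + exact: dC_derivable F1.
  + exact: dC_derivable G2.
- exact: dC_derivable (dC_mul F1 G2).
- exact: dC_derivable (dC_mul F2 G1).
Qed.

Lemma cderive_cst z u v : cderive v (fun _ : V => z) u = 0.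
Proof. by apply: complex_ext => /=; rewrite (derive_cst (_ z)). Qed.

Lemma cderiveZ z F u v : cdC 1 F ->
  cderive v (fun u => z * F u) u = z * cderive v F u.
Proof.
move=> HF; rewrite cderiveM //; last exact: cdC_cst.
by rewrite cderive_cst mul0r add0r.
Qed.

Lemma cderive_sum I (r : seq I) (F : I -> V -> C) u v :
  (forall i, cdC 1 (F i)) ->
  cderive v (fun u => \sum_(i <- r) F i u) u = \sum_(i <- r) cderive v (F i) u.
Proof.
move=> HF; elim: r => [|i r IH].
  rewrite big_nil -[RHS](cderive_cst 0 u v); congr (cderive v _ u).
  by apply/funext => p; rewrite big_nil.
rewrite big_cons -IH -cderiveD //; last exact: cdC_sum.
by congr (cderive v _ u); apply/funext => p; rewrite big_cons.
Qed.

Lemma cmeanD b F G u : cdC 0 F -> cdC 0 G ->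
  cmean b (fun u => F u + G u) u = cmean b F u + cmean b G u.
Proof.
move=> [[F1 _] [F2 _]] [[G1 _] [G2 _]].
apply: complex_ext; rewrite ?creD ?cimD /= /mean_along.
  rewrite -mean01D; [|exact: (@continuous_line _ _ _ b u F1)|
                      exact: (@continuous_line _ _ _ b u G1)].
  by congr mean01; apply/funext => s /=; rewrite creD.
rewrite -mean01D; [|exact: (@continuous_line _ _ _ b u F2)|
                    exact: (@continuous_line _ _ _ b u G2)].
by congr mean01; apply/funext => s /=; rewrite cimD.
Qed.

Lemma cmean_factor b G F u : cdC 0 F -> (forall p (s : R), G (p + s *: b) = G p) ->
  cmean b (fun u => G u * F u) u = G u * cmean b F u.
Proof.
move=> [[F1 _] [F2 _]] Gb.
have c1 := @continuous_line _ _ _ b u F1.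
have c2 := @continuous_line _ _ _ b u F2.
apply: complex_ext; rewrite ?creM ?cimM /= /mean_along -!mean01Z //.
  rewrite -mean01B; [|exact: continuous_scale c1|exact: continuous_scale c2].
  by congr mean01; apply/funext => s /=; rewrite creM Gb.
rewrite -mean01D; [|exact: continuous_scale c2|exact: continuous_scale c1].
by congr mean01; apply/funext => s /=; rewrite cimM Gb.
Qed.

Lemma cmean_dC k b F : cdC k F -> cdC k (cmean b F).
Proof. by move=> [F1 F2]; split; apply: mean_along_dC. Qed.

Lemma cmean_derive b F u v : cdC 1 F ->
  cderive v (cmean b F) u = cmean b (cderive v F) u.
Proof.
move=> [F1 F2]; apply: complex_ext => /=.
  exact: (mean_along_derive b v u F1).
exact: (mean_along_derive b v u F2).
Qed.

Definition line_invariant b F := forall u (a : R), F (u + a *: b) = F u.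

Lemma cmean_invariant b F : cdC 1 F -> (forall u, F (u + b) = F u) ->
  line_invariant b (cmean b F).
Proof.
move=> [F1 F2] Fb u a; apply: complex_ext => /=.
  by apply: mean_along_invariant => // p /=; rewrite Fb.
by apply: mean_along_invariant => // p /=; rewrite Fb.
Qed.

Lemma cmean_shift b F c : (forall u, F (u + c) = F u) ->
  forall u, cmean b F (u + c) = cmean b F u.
Proof.
move=> Fc u; congr (Complex (mean01 _) (mean01 _)); apply/funext => s /=;
  by rewrite addrAC Fc.
Qed.

Lemma cmean_line_invariant b F c :
  line_invariant c F -> line_invariant c (cmean b F).
Proof. by move=> Fc u a; apply: cmean_shift => p; exact: Fc. Qed.

Definition cexp (t : R) : C := (cos t +i* sin t)%C.

Lemma cexpD s t : cexp (s + t) = cexp s * cexp t.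
Proof.
apply: complex_ext; rewrite ?creM ?cimM /=; first exact: cosD.
by rewrite sinD addrC.
Qed.

Lemma cexp0 : cexp 0 = 1.
Proof. by rewrite /cexp cos0 sin0. Qed.

Lemma cexpN_mul t : cexp t * cexp (- t) = 1.
Proof. by rewrite -cexpD subrr cexp0. Qed.

Lemma cexp_2pi_int (k : int) : cexp (2 * pi * k%:~R) = 1.
Proof.
have nat_case n : cexp (2 * pi * n%:R) = 1.
  elim: n => [|n IH]; first by rewrite mulr0 cexp0.
  rewrite -[n.+1%:R]natr1 mulrDr cexpD IH mul1r mulr1 /cexp.
  by rewrite mulr_natl cos2pi sin2pi.
case: k => n; first exact: nat_case.
rewrite NegzE rmorphN /= mulrN.
by have := cexpN_mul (2 * pi * n.+1%:R); rewrite nat_case mul1r.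
Qed.

(* With t(u + s b) = t(u) + s, the hypothesis says that all the Fourier
   coefficients of s |-> F (u + s b) vanish. *)
Lemma cmean_moments_eq0 b (t : V -> R) F : cdC 0 F -> continuous t ->
  (forall u s, t (u + s *: b) = t u + s) ->
  (forall (k : int) u, cmean b (fun p => F p * cexp (2 * pi * k%:~R * t p)) u = 0) ->
  forall u, F u = 0.
Proof.
(* The segment is started half a period before [u], so that [u] is its midpoint, the only place
   where [cos_moments_eq0] gives information. *)
move=> HF ct tb F0 u; set u0 := u - 2^-1 *: b.
have [[F1 _] [F2 _]] := HF.
have c1 := @continuous_line _ _ _ b u0 F1.
have c2 := @continuous_line _ _ _ b u0 F2.
pose S (k : int) (s : R) := sin (2 * pi * k%:~R * s).
have cS k : continuous (S k).
  by apply: continuous_sin_comp; apply: continuous_scale => ?; exact: cvg_id.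
have H k : mean01 (fun s => cre (F (u0 + s *: b)) * cosk k s)
           - mean01 (fun s => cim (F (u0 + s *: b)) * S k s) = 0 /\
           mean01 (fun s => cim (F (u0 + s *: b)) * cosk k s)
           + mean01 (fun s => cre (F (u0 + s *: b)) * S k s) = 0.
  (* The constant phase in front cancels [t u0], which leaves the character [cexp (2 * pi * k * s)]
     in the parameter [s] alone. *)
  have E : cmean b (fun p => cexp (- (2 * pi * k%:~R * t u0)) *
       (F p * cexp (2 * pi * k%:~R * t p))) u0 = 0.
    rewrite (@cmean_factor b (fun=> cexp (- (2 * pi * k%:~R * t u0)))) //.
      by rewrite F0 mulr0.
    apply: cdC_mul => //; split; split=> //.
      by apply: continuous_cos_comp; exact: continuous_scale.
    by apply: continuous_sin_comp; exact: continuous_scale.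
  have E1 s : cexp (- (2 * pi * k%:~R * t u0)) *
      (F (u0 + s *: b) * cexp (2 * pi * k%:~R * t (u0 + s *: b))) =
      F (u0 + s *: b) * cexp (2 * pi * k%:~R * s).
    by rewrite mulrCA -cexpD tb; congr (_ * cexp _); ring.
  split.
    rewrite -mean01B; [|exact: continuous_mul c1 (@cosk_continuous R k)
                       |exact: continuous_mul c2 (cS k)].
    have := congr1 cre E; rewrite /= /mean_along => <-.
    by congr mean01; apply/funext => s; rewrite /= E1 creM.
  rewrite -mean01D; [|exact: continuous_mul c2 (@cosk_continuous R k)
                     |exact: continuous_mul c1 (cS k)].
  have := congr1 cim E; rewrite /= /mean_along => <-.
  by congr mean01; apply/funext => s; rewrite /= E1 cimM addrC.
(* Cosine is even and sine is odd in [k], so combining the equations for [k] and [- k] removes the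
   sine terms and leaves the cosine moments of each part of [F]. *)
have ckN k : cosk (- k) = cosk k :> (R -> R).
  by apply/funext => s; rewrite /cosk rmorphN /= mulrN mulNr cosN.
have SN k (g : R -> R) : continuous g ->
    mean01 (fun s => g s * S (- k) s) = - mean01 (fun s => g s * S k s).
  move=> cg; rewrite -[RHS]mulN1r -mean01Z; last exact: continuous_mul cg (cS k).
  congr mean01; apply/funext => s.
  by rewrite /S rmorphN /= mulrN mulNr sinN; ring.
have uE : u = u0 + (1 / 2) *: b by rewrite /u0 mul1r subrK.
apply: complex_ext; rewrite uE.
  apply: (cos_moments_eq0 c1) => k.
  have [h1 _] := H k; have [h2 _] := H (- k).
  by move: h2; rewrite ckN (SN k _ c2) /=; move: h1 => /=; lra.
apply: (cos_moments_eq0 c2) => k.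
have [_ h1] := H k; have [_ h2] := H (- k).
by move: h2; rewrite ckN (SN k _ c1) /=; move: h1 => /=; lra.
Qed.

End ComplexFunctions.

(** * Fourier coefficients on a flat torus *)

Section Fourier.
Variables (R : realType) (B : 'M[R]_3).
Hypothesis unitB : B \in unitmx.
Local Notation C := R[i].
Local Notation V := 'rV[R]_3.
Implicit Types (F G : V -> C) (u v w : V) (k : 'rV[int]_3) (z : C).

Definition phase w u : C := cexp (dot w u).

Lemma phase_cdC m w : cdC m (phase w).
Proof.
split.
  by apply: dC_ext (dC_phase m w 1 0) => u; rewrite mul1r mul0r addr0.
by apply: dC_ext (dC_phase m w 0 1) => u; rewrite mul1r mul0r add0r.
Qed.

Lemma cderive_phase w u v :
  cderive v (phase w) u = 'i%C * ((dot w v)%:C)%C * phase w u.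
Proof.
have [_ E1] := @is_derive_dot_comp _ _ cos (fun s => - sin s) w u v (@is_derive_cos R).
have [_ E2] := @is_derive_dot_comp _ _ sin cos w u v (@is_derive_sin R).
apply: complex_ext; rewrite /cderive /= ?creM ?cimM /=.
  by rewrite E1; ring.
by rewrite E2; ring.
Qed.

Lemma phaseD w w' u : phase (w + w') u = phase w u * phase w' u.
Proof. by rewrite /phase dotDl cexpD. Qed.

Lemma phase_shift w u v : phase w (u + v) = phase w u * phase w v.
Proof. by rewrite /phase dotDr cexpD. Qed.

Lemma phase0l u : phase 0 u = 1.
Proof. by rewrite /phase dot0l cexp0. Qed.

(** The rows of the transposed inverse of [B] are the dual basis, so these are the vectors of the
    dual lattice scaled by 2 pi. With this scale [phase] needs no further constant and the Laplace
    eigenvalue is the squared length. *)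
Definition freq k : V := (2 * pi) *: (map_mx intr k *m (invmx B)^T).

Lemma freqD k k' : freq (k + k') = freq k + freq k'.
Proof. by rewrite /freq map_mxD mulmxDl scalerDr. Qed.

Lemma freqN k : freq (- k) = - freq k.
Proof. by rewrite /freq map_mxN mulNmx scalerN. Qed.

Lemma freq0 : freq 0 = 0.
Proof. by rewrite /freq map_mx0 mul0mx scaler0. Qed.

Lemma freqK k : map_mx intr k = (2 * pi)^-1 *: (freq k *m B^T) :> 'rV[R]_3.
Proof.
have pi0 : 2 * pi != 0 :> R by rewrite mulf_neq0 // gt_eqF // pi_gt0.
rewrite /freq -scalemxAl -mulmxA -trmx_mul mulmxV // trmx1 mulmx1.
by rewrite scalerA mulVf // scale1r.
Qed.

Lemma freq_inj : injective freq.
Proof.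
move=> k k' E; have := freqK k; rewrite E -freqK => /rowP e.
by apply/rowP => i; have := e i; rewrite !mxE => /intr_inj.
Qed.

Lemma dot_freq_basis k i : dot (freq k) (row i B) = 2 * pi * (k 0 i)%:~R.
Proof.
rewrite /freq dotZl; congr (_ * _); rewrite /dot -mulmxA -trmx_mul -row_mul.
by rewrite mulmxV // row1 trmx_delta -colE !mxE.
Qed.

Definition periodic_fun (T : Type) (F : V -> T) :=
  forall l, lattice B l -> forall p, F (p + l) = F p.

Lemma lattice_row i : lattice B (row i B).
Proof.
exists (delta_mx 0 i); rewrite map_delta_mx; exact: rowE.
Qed.

Lemma phase_periodic k : periodic_fun (phase (freq k)).
Proof.
move=> l [c ->] p; rewrite phase_shift.
suff -> : phase (freq k) (map_mx intr c *m B) = 1 by rewrite mulr1.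
rewrite /phase /freq dotZl.
have -> : dot (map_mx intr k *m (invmx B)^T) (map_mx intr c *m B) =
          ((k *m c^T) 0 0)%:~R.
  rewrite /dot trmx_mul mulmxA -(mulmxA _ _ B^T) -trmx_mul mulmxV //.
  by rewrite trmx1 mulmx1 map_trmx -map_mxM mxE.
exact: cexp_2pi_int.
Qed.

Lemma periodicM F G :
  periodic_fun F -> periodic_fun G -> periodic_fun (fun u => F u * G u).
Proof. by move=> HF HG l Hl p; rewrite HF ?HG. Qed.

Lemma derive_periodic (f : V -> R) v : periodic_fun f -> periodic_fun ('D_v f).
Proof.
move=> Hf l Hl p; rewrite /derive.
suff -> : (fun h => h^-1 *: ((f \o shift (p + l)) (h *: v) - f (p + l))) =
          (fun h => h^-1 *: ((f \o shift p) (h *: v) - f p)) by [].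
by apply/funext => h /=; rewrite addrA !(Hf _ Hl).
Qed.

Lemma cderive_periodic F v : periodic_fun F -> periodic_fun (cderive v F).
Proof.
move=> HF l Hl p; apply: complex_ext => /=;
  by apply: derive_periodic => // l' Hl' q; rewrite /= HF.
Qed.

Local Notation b i := (row i B).
Local Notation i0 := (0 : 'I_3).
Local Notation i1 := (1 : 'I_3).
Local Notation i2 := (2%:R : 'I_3).

Lemma sum3E (W : nmodType) (G : 'I_3 -> W) : \sum_i G i = G i0 + G i1 + G i2.
Proof.
rewrite !big_ord_recl big_ord0 addr0 addrA.
by congr (_ + G _ + G _); apply/val_inj.
Qed.

Lemma dot_freq k u :
  dot (freq k) u = 2 * pi * \sum_i (k 0 i)%:~R * (u *m invmx B) 0 i.
Proof.
rewrite /freq dotZl; congr (_ * _).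
rewrite {1}/dot -mulmxA -trmx_mul -[LHS]/(dot (map_mx intr k) (u *m invmx B)).
by rewrite dotE; apply: eq_bigr => i _; rewrite mxE.
Qed.

(** Average over the fundamental cell with corner [u]. The corner is kept as an argument so that the
    mean can be differentiated. *)
Definition tmean F u : C := cmean (b i0) (cmean (b i1) (cmean (b i2) F)) u.

(** Each average creates invariance along its own basis vector, and the later averages preserve both
    this invariance and the remaining periods. In the end all three coordinate lines are lines of
    constancy. *)
Lemma tmean_cst F u : cdC 1 F -> periodic_fun F -> tmean F u = tmean F 0.
Proof.
move=> HF pF.
have pb i : forall u, F (u + b i) = F u by move=> p; apply/pF/lattice_row.
have H2 := cmean_dC (b i2) HF.
have H1 := cmean_dC (b i1) H2.
have I2 := cmean_invariant HF (pb i2).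
have P2 i := @cmean_shift _ _ (b i2) F (b i) (pb i).
have P1 i := @cmean_shift _ _ (b i1) _ (b i) (P2 i).
have I1 := cmean_invariant H2 (P2 i1).
have I0 : line_invariant (b i0) (tmean F) := cmean_invariant H1 (P1 i0).
have I1' : line_invariant (b i1) (tmean F) by exact: cmean_line_invariant.
have I2' : line_invariant (b i2) (tmean F).
  by do 2!apply: cmean_line_invariant.
have -> : u = 0 + (u *m invmx B) 0 i0 *: b i0 + (u *m invmx B) 0 i1 *: b i1
            + (u *m invmx B) 0 i2 *: b i2.
  by rewrite add0r -{1}[u](mulmxKV unitB) [LHS]mulmx_sum_row sum3E.
by rewrite I2' I1' I0.
Qed.

Lemma tmean_derive F v : cdC 1 F -> periodic_fun F -> tmean (cderive v F) 0 = 0.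
Proof.
move=> HF pF.
have H2 := cmean_dC (b i2) HF.
have H1 := cmean_dC (b i1) H2.
have E : tmean (cderive v F) 0 = cderive v (tmean F) 0.
  rewrite /tmean cmean_derive //; congr (cmean _ _ _); apply/funext => p.
  rewrite cmean_derive //; congr (cmean _ _ _); apply/funext => q.
  by rewrite cmean_derive.
have Ec : tmean F = fun=> tmean F 0 by apply/funext => p; exact: tmean_cst.
by rewrite E Ec; exact: cderive_cst.
Qed.

Lemma tmeanD F G u : cdC 0 F -> cdC 0 G ->
  tmean (fun p => F p + G p) u = tmean F u + tmean G u.
Proof.
move=> HF HG; have HF2 := cmean_dC (b i2) HF; have HG2 := cmean_dC (b i2) HG.
rewrite /tmean -cmeanD //; [|exact: cmean_dC|exact: cmean_dC].
congr cmean; apply/funext => p; rewrite -cmeanD //; congr cmean.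
by apply/funext => q; rewrite cmeanD.
Qed.

Lemma tmeanZ z F u : cdC 0 F -> tmean (fun p => z * F p) u = z * tmean F u.
Proof.
move=> HF; have HF2 := cmean_dC (b i2) HF.
rewrite /tmean -(@cmean_factor _ _ (b i0) (fun=> z)) //; last exact: cmean_dC.
congr cmean; apply/funext => p; rewrite -(@cmean_factor _ _ (b i1) (fun=> z)) //.
congr cmean; apply/funext => q; rewrite -(@cmean_factor _ _ (b i2) (fun=> z)) //.
Qed.

Definition fcoef k F : C := tmean (fun p => F p * phase (freq (- k)) p) 0.

Lemma tmeanE F u : tmean F u = cmean (b i0) (cmean (b i1) (cmean (b i2) F)) u.
Proof. by []. Qed.

Lemma fcoefE k F : fcoef k F = tmean (fun p => F p * phase (freq (- k)) p) 0.
Proof. by []. Qed.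

(* Without this, failing unifications unfold the integrals. *)
Global Opaque tmean.

Lemma fcoefD k F G : cdC 0 F -> cdC 0 G ->
  fcoef k (fun p => F p + G p) = fcoef k F + fcoef k G.
Proof.
move=> HF HG; rewrite /fcoef -tmeanD; try exact/cdC_mul/phase_cdC.
by apply: (congr1 (tmean^~ 0)); apply/funext => p; rewrite mulrDl.
Qed.

Lemma fcoefZ k z F : cdC 0 F -> fcoef k (fun p => z * F p) = z * fcoef k F.
Proof.
move=> HF; rewrite /fcoef -tmeanZ; last exact/cdC_mul/phase_cdC.
by apply: (congr1 (tmean^~ 0)); apply/funext => p; rewrite mulrA.
Qed.

Lemma fcoef_sum k I (r : seq I) (F : I -> V -> C) :
  (forall i, cdC 0 (F i)) ->
  fcoef k (fun p => \sum_(i <- r) F i p) = \sum_(i <- r) fcoef k (F i).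
Proof.
move=> HF; elim: r => [|i r IH].
  rewrite big_nil -[RHS](mul0r (fcoef k (fun=> 0))) -fcoefZ; last exact: cdC_cst.
  by apply: (congr1 (fcoef k)); apply/funext => p; rewrite big_nil mul0r.
rewrite big_cons -IH -fcoefD; [|exact: HF|exact: cdC_sum].
by apply: (congr1 (fcoef k)); apply/funext => p; rewrite big_cons.
Qed.

Global Opaque fcoef.

(** Integration by parts: the derivative of [F] times the conjugate phase has mean zero by
    [tmean_derive]. *)
Lemma fcoef_derive k F v : cdC 1 F -> periodic_fun F ->
  fcoef k (cderive v F) = 'i%C * ((dot (freq k) v)%:C)%C * fcoef k F.
Proof.
move=> HF pF.
have Hph m := phase_cdC m (freq (- k)).
have HM := cdC_mul HF (Hph 1%N).
rewrite !fcoefE.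
have := tmean_derive v HM (periodicM pF (phase_periodic (- k))).
have HD := cdC_derive v HF.
have -> : cderive v (fun u => F u * phase (freq (- k)) u) = fun u =>
    cderive v F u * phase (freq (- k)) u +
    (- ('i%C * ((dot (freq k) v)%:C)%C)) * (F u * phase (freq (- k)) u).
  apply/funext => u; rewrite cderiveM // cderive_phase freqN dotNl.
  by rewrite rmorphN /=; ring.
have HM0 := cdCW HM.
rewrite tmeanD; last 2 first.
- exact: cdC_mul HD (Hph 0%N).
- by apply: cdC_mul => //; exact: cdC_cst.
by rewrite tmeanZ // mulNr => /eqP; rewrite subr_eq0 => /eqP.
Qed.

(** For distinct indices no integral is computed: with [w] the difference of frequencies, the
    derivative of [phase w] along [w] is [phase w] times the nonzero constant $i|w|^2$, and
    derivatives have mean zero. *)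
Lemma fcoef_phase k k' : fcoef k (phase (freq k')) = (k == k')%:R.
Proof.
rewrite fcoefE.
have -> : (fun p => phase (freq k') p * phase (freq (- k)) p) = phase (freq (k' - k)).
  by apply/funext => p; rewrite -phaseD -freqD.
have [<-|nkk] := eqVneq k k'.
  rewrite subrr freq0.
  have -> : phase 0 = fun=> 1 by apply/funext => p; rewrite phase0l.
  have c1 bb : cmean bb (fun _ : V => (1 : C)) = fun=> 1.
    by apply/funext => u; apply: complex_ext => /=; exact: mean01_cst.
  by rewrite tmeanE !c1.
set w := freq (k' - k).
have w0 : w != 0.
  by rewrite -freq0; apply: contraNneq nkk => /freq_inj /eqP; rewrite subr_eq0 eq_sym.
have := tmean_derive w (phase_cdC 1 w) (@phase_periodic _).
have -> : cderive w (phase w) = fun u => ('i%C * ((dot w w)%:C)%C) * phase w u.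
  by apply/funext => u; rewrite cderive_phase.
rewrite tmeanZ; last exact: phase_cdC.
move=> /eqP; rewrite mulf_eq0 => /orP[/eqP/(congr1 (@complex.Im R))|/eqP //].
rewrite cimM /= mul0r add0r mul1r => /eqP.
by rewrite dot_eq0 (negbTE w0).
Qed.

(** The one-variable statement [cmean_moments_eq0] is applied in the directions of the three basis
    vectors in turn, each time to the function left after averaging against characters of the
    previous coordinates. *)
Lemma fcoef_eq0 F : cdC 1 F -> periodic_fun F ->
  (forall k, fcoef k F = 0) -> forall u, F u = 0.
Proof.
move=> HF pF F0.
pose t (i : 'I_3) u : R := (u *m invmx B) 0 i.
pose e (i : 'I_3) (k : int) u : C := cexp (2 * pi * k%:~R * t i u).
have tE i j u s : t i (u + s *: b j) = t i u + s * (i == j)%:R.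
  rewrite /t mulmxDl mxE; congr (_ + _).
  by rewrite -scalemxAl -row_mul mulmxV // row1 !mxE eqxx.
have ct i : continuous (t i).
  have -> : t i = dot (row i (invmx B)^T).
    apply/funext => u; rewrite /t dotC /dot mxE [RHS]mxE.
    by apply: eq_bigr => j _; rewrite !mxE.
  exact: dot_continuous.
have eb (i j : 'I_3) (k : int) u (s : R) : i != j -> e i k (u + s *: b j) = e i k u.
  by move=> /negbTE ij; rewrite /e tE ij mulr0 addr0.
have ce i (k : int) : cdC 0 (e i k).
  split; split=> //.
    by apply: continuous_cos_comp; apply: continuous_scale; exact: ct.
  by apply: continuous_sin_comp; apply: continuous_scale; exact: ct.
have phE k u : phase (freq k) u = e i2 (k 0 i2) u * e i1 (k 0 i1) u * e i0 (k 0 i0) u.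
  by rewrite /e -!cexpD /phase dot_freq sum3E; congr cexp; rewrite /t; ring.
have H0 := cdCW HF.
(* The iterated twisted average is the mean of [F] times a full phase, since the character of one
   coordinate is constant along the other basis vectors and moves out of their averages. By
   [tmean_cst] the mean vanishes at every [u], not only at 0. *)
have tm (k2 k1 k0 : int) u :
    cmean (b i0) (fun p => cmean (b i1) (fun p => cmean (b i2)
      (fun p => F p * e i2 k2 p) p * e i1 k1 p) p * e i0 k0 p) u = 0.
  pose k : 'rV[int]_3 := \row_i (if i == i2 then k2 else if i == i1 then k1 else k0).
  have [q2 q1 q0] : [/\ k 0 i2 = k2, k 0 i1 = k1 & k 0 i0 = k0].
    by split; rewrite mxE.
  have HM := cdC_mul HF (phase_cdC 1 (freq k)).
  have : tmean (fun p => F p * phase (freq k) p) u = 0.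
    rewrite tmean_cst //; last exact: periodicM (phase_periodic k).
    by have := F0 (- k); rewrite fcoefE opprK.
  have cA : cdC 0 (cmean (b i2) (fun p => F p * e i2 k2 p)).
    exact/cmean_dC/cdC_mul/ce.
  have E2 : cmean (b i2) (fun p => F p * phase (freq k) p) = fun p =>
      e i0 k0 p * (cmean (b i2) (fun p => F p * e i2 k2 p) p * e i1 k1 p).
    have -> : (fun p => F p * phase (freq k) p) =
        fun p => (e i1 k1 p * e i0 k0 p) * (F p * e i2 k2 p).
      by apply/funext => p; rewrite phE q2 q1 q0; ring.
    apply/funext => p.
    rewrite (@cmean_factor _ _ _ (fun p => e i1 k1 p * e i0 k0 p)).
    - by ring.
    - exact: cdC_mul.
    - by move=> *; rewrite !eb.
  have E1 : cmean (b i1) (cmean (b i2) (fun p => F p * phase (freq k) p)) = fun p =>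
      e i0 k0 p * cmean (b i1)
        (fun p => cmean (b i2) (fun p => F p * e i2 k2 p) p * e i1 k1 p) p.
    apply/funext => p; rewrite E2 cmean_factor //; first exact: cdC_mul.
    by move=> *; rewrite eb.
  move=> <-; rewrite tmeanE E1; congr (cmean _ _ u).
  by apply/funext => p; rewrite mulrC.
apply: (cmean_moments_eq0 (b := b i2) (t := t i2)) => //.
  by move=> u s; rewrite tE mulr1.
move=> k2; apply: (cmean_moments_eq0 (b := b i1) (t := t i1)) => //.
- exact/cmean_dC/cdC_mul/ce.
- by move=> u s; rewrite tE mulr1.
move=> k1; apply: (cmean_moments_eq0 (b := b i0) (t := t i0)) => //.
- exact/cmean_dC/(cdC_mul _ (ce _ _))/cmean_dC/cdC_mul/ce.
- by move=> u s; rewrite tE mulr1.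
move=> k0 u; exact: tm.
Qed.

End Fourier.

(** * Rigidity of the second-order relations *)

Section OrthogonalFrame.
Variables (R : realType).
Implicit Types (u v w : 'rV[R]_3) (M : 'M[R]_3).

Definition bform M u v : R := dot (u *m M) v.

Lemma bformDl M u v w : bform M (u + v) w = bform M u w + bform M v w.
Proof. by rewrite /bform mulmxDl dotDl. Qed.

Lemma bformDr M u v w : bform M w (u + v) = bform M w u + bform M w v.
Proof. by rewrite /bform dotDr. Qed.

Lemma bformZl M c u v : bform M (c *: u) v = c * bform M u v.
Proof. by rewrite /bform -scalemxAl dotZl. Qed.

Lemma bformZr M c u v : bform M u (c *: v) = c * bform M u v.
Proof. by rewrite /bform dotZr. Qed.

Lemma bformC M u v : M^T = M -> bform M u v = bform M v u.
Proof.
by move=> Ms; rewrite /bform dotC /dot trmx_mul Ms mulmxA.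
Qed.

Lemma bform_sum M u v : bform M u v = \sum_i \sum_j M i j * (u 0 i * v 0 j).
Proof.
rewrite exchange_big /bform dotE; apply: eq_bigr => j _.
by rewrite mxE mulr_suml; apply: eq_bigr => i _; ring.
Qed.

Lemma bform_delta M i j : bform M (delta_mx 0 i) (delta_mx 0 j) = M i j.
Proof. by rewrite /bform -rowE /dot trmx_delta -colE !mxE. Qed.

(** Three nonzero orthogonal vectors are the rows of an invertible matrix, so the remainder, being
    orthogonal to all of them, is zero. *)
Lemma orthogonal_expansion (E : 'I_3 -> 'rV[R]_3) u :
  (forall i, E i != 0) -> (forall i j, i != j -> dot (E i) (E j) = 0) ->
  u = \sum_i (dot u (E i) / dot (E i) (E i)) *: E i.
Proof.
move=> E0 EE; pose F : 'M[R]_3 := \matrix_i E i.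
pose d : 'rV[R]_3 := \row_i (dot (E i) (E i))^-1.
have FF : F *m (F^T *m diag_mx d) = 1%:M.
  apply/matrixP => i j; rewrite mulmxA mul_mx_diag !mxE.
  have -> : \sum_k F i k * F^T k j = dot (E i) (E j).
    by rewrite dotE; apply: eq_bigr => k _; rewrite !mxE.
  have [<-|ij] := eqVneq i j; last by rewrite EE // mul0r.
  by rewrite mulfV // dot_eq0.
have [uF _] := mulmx1_unit FF.
apply/eqP; rewrite -subr_eq0; set w := _ - _; apply/eqP.
have : w *m F^T = 0.
  apply/rowP => j; rewrite [RHS]mxE.
  transitivity (dot w (E j)).
    by rewrite dotE mxE; apply: eq_bigr => k _; rewrite !mxE.
  rewrite /w dotBl dot_suml; under eq_bigr do rewrite dotZl.
  rewrite (bigD1 j) //= big1 ?addr0 => [|i ij]; last by rewrite (EE i j) // mulr0.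
  by rewrite divfK ?dot_eq0 // subrr.
move=> /(congr1 (mulmx^~ (invmx F^T))).
by rewrite mulmxK ?unitmx_tr // mul0mx.
Qed.

Definition triple u v w (i : 'I_3) : 'rV[R]_3 :=
  if i == 0 then u else if i == 1 then v else w.

Lemma orthogonal_triple u v w p :
  u != 0 -> v != 0 -> w != 0 -> dot u v = 0 -> dot u w = 0 -> dot v w = 0 ->
  p = (dot p u / dot u u) *: u + (dot p v / dot v v) *: v +
      (dot p w / dot w w) *: w.
Proof.
move=> u0 v0 w0 uv uw vw.
rewrite {1}(@orthogonal_expansion (triple u v w) p).
- by rewrite !big_ord_recl big_ord0 addr0 addrA.
- by case=> [[|[|[|]]]].
- by case=> [[|[|[|]]]] // ?; case=> [[|[|[|]]]] // ? _; rewrite /triple //= dotC.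
Qed.

(** The frame diagonalizes both [M] and the metric, and the last hypothesis says that [M] has the
    same eigenvalue on [u] and [v]. Subtracting that multiple of the metric leaves a form that sees
    only the [w] component. *)
Lemma diagonal_form M u v w : M^T = M ->
  u != 0 -> v != 0 -> w != 0 -> dot u v = 0 -> dot u w = 0 -> dot v w = 0 ->
  bform M u v = 0 -> bform M u w = 0 -> bform M v w = 0 ->
  bform M u u * dot v v = bform M v v * dot u u ->
  exists s t, forall p q, bform M p q = s * dot p q + t * dot p w * dot q w.
Proof.
move=> Ms u0 v0 w0 uv uw vw Muv Muw Mvw E.
have d0 (x : 'rV[R]_3) : x != 0 -> dot x x != 0 by rewrite dot_eq0.
have [[du dv] dw] := (d0 _ u0, d0 _ v0, d0 _ w0).
have [[vu wu] wv] := (etrans (dotC v u) uv, etrans (dotC w u) uw, etrans (dotC w v) vw).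
have [[Mvu Mwu] Mwv] := (etrans (bformC v u Ms) Muv, etrans (bformC w u Ms) Muw,
  etrans (bformC w v Ms) Mvw).
exists (bform M u u / dot u u).
exists ((bform M w w / dot w w - bform M u u / dot u u) / dot w w) => p q.
have fr x : x = (dot x u / dot u u) *: u + (dot x v / dot v v) *: v +
      (dot x w / dot w w) *: w by exact: orthogonal_triple.
have E' : bform M v v = bform M u u / dot u u * dot v v.
  by rewrite mulrAC E mulfK.
rewrite {1 2}(fr p) {1 2}(fr q).
rewrite !(bformDl, bformDr, bformZl, bformZr, dotDl, dotDr, dotZl, dotZr).
rewrite uv uw vw vu wu wv Muv Muw Mvw Mvu Mwu Mwv E'.
by field; rewrite dw dv du.
Qed.

End OrthogonalFrame.

Section Rigidity.
Variables (R : realType) (K : zmodType) (eta : K -> 'rV[R]_3).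
Hypothesis etaD : {morph eta : k l / k + l}.
Hypothesis eta_inj : injective eta.
Local Notation C := R[i].

Lemma etaB k l : eta (k - l) = eta k - eta l.
Proof. by apply/eqP; rewrite eq_sym subr_eq -etaD subrK. Qed.

(** The indices [k] and [k'] may coincide: the sum is [a] or [2 a]. This covers an index fixed by
    the symmetry [k] to [kap - k]. *)
Lemma sum_pair_neq0 (S : seq K) (f : K -> C) k k' (a : C) : uniq S ->
  k \in S -> k' \in S -> f k = a -> f k' = a -> a != 0 ->
  (forall l, l != k -> l != k' -> f l = 0) -> \sum_(l <- S) f l != 0.
Proof.
move=> uS kS k'S fk fk' a0 f0; rewrite (bigD1_seq k) //= fk.
have [kk|kk] := eqVneq k k'.
  rewrite big1 ?addr0 // => l lk; apply: f0 => //; by rewrite -kk.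
have k'k : k' != k by rewrite eq_sym.
rewrite big_mkcond /= (bigD1_seq k') //= k'k fk' big1 ?addr0.
  by rewrite -mulr2n -mulr_natr mulf_neq0 // pnatr_eq0.
by move=> l lk'; case: ifP => // lk; exact: f0.
Qed.

Variables (S : seq K) (h : K -> C) (kap : K) (M : 'M[R]_3).
Hypothesis uniqS : uniq S.
Hypothesis kap0 : kap != 0.
Hypothesis hS : forall k, h k != 0 -> k \in S.
Hypothesis h_sphere : forall k, h k != 0 -> dot (eta k) (eta k) = 3.
Hypothesis h_sym : forall k, h (kap - k) = h k.
Hypothesis h_sum0 : \sum_(k <- S) h k = 0.
Hypothesis h_sum2 : forall w,
  \sum_(k <- S) h k * ((dot (eta k) w * dot (eta (kap - k)) w)%:C)%C = 0.
Hypothesis symM : M^T = M.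
Hypothesis M_neq0 : M != 0.
Hypothesis trM : \tr M = 0.
Hypothesis hM : forall k, h k != 0 -> bform M (eta k) (eta k) = 0.

Local Notation om := (eta kap).
(** The vectors $\tau_k$, given by an equation instead of a definition so that they stay atomic
    under rewriting. *)
Variable offset : K -> 'rV[R]_3.
Hypothesis offsetE : forall k, offset k = eta k - 2^-1 *: om.

Lemma eta_offset k : eta k = 2^-1 *: om + offset k.
Proof. by rewrite offsetE addrC subrK. Qed.

Lemma offset_sub k : offset (kap - k) = - offset k.
Proof.
by rewrite !offsetE etaB; apply/rowP => i; rewrite !mxE; field.
Qed.

Lemma offset_inj : injective offset.
Proof. by move=> k l; rewrite !offsetE => /addIr /eta_inj. Qed.

Lemma h_sub k : h k != 0 -> h (kap - k) != 0.
Proof. by rewrite h_sym. Qed.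

(** Since [eta k] and [eta (kap - k)] are $\omega/2 \pm \tau_k$, the product in [h_sum2] is a
    difference of squares, and its constant part is removed by [h_sum0]. *)
Lemma offset_sum2 w : \sum_(k <- S) h k * ((dot (offset k) w ^+ 2)%:C)%C = 0.
Proof.
have E k : h k * ((dot (offset k) w ^+ 2)%:C)%C =
   (((dot om w / 2) ^+ 2)%:C)%C * h k +
   - (h k * ((dot (eta k) w * dot (eta (kap - k)) w)%:C)%C).
  rewrite (eta_offset k) (eta_offset (kap - k)) offset_sub.
  rewrite !dotDl dotNl !dotZl.
  have -> : (2^-1 * dot om w + dot (offset k) w) * (2^-1 * dot om w - dot (offset k) w)
      = (dot om w / 2) ^+ 2 - dot (offset k) w ^+ 2 by ring.
  by rewrite rmorphB /=; ring.
rewrite (eq_bigr _ (fun k _ => E k)) big_split /= sumrN -mulr_sumr.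
by rewrite h_sum0 h_sum2 mulr0 subr0.
Qed.

Lemma om_neq0 : om != 0.
Proof.
apply: contraNneq kap0 => E.
have e0 : eta 0 = 0 by rewrite -(subrr kap) etaB subrr.
by apply/eqP/eta_inj; rewrite E e0.
Qed.

(** By [h_sym] both $\omega/2 + \tau_k$ and $\omega/2 - \tau_k$ satisfy the two quadratic equations.
    Their differences give the orthogonality relations, their sums the values on $\tau_k$. *)
Lemma support_offset k : h k != 0 ->
  [/\ dot (offset k) om = 0,
      dot (offset k) (offset k) = 3 - dot om om / 4,
      bform M om (offset k) = 0 &
      bform M (offset k) (offset k) = - bform M om om / 4].
Proof.
move=> hk; have hk' := h_sub hk.
have := h_sphere hk; have := h_sphere hk'; have := hM hk; have := hM hk'.
rewrite (eta_offset k) (eta_offset (kap - k)) offset_sub -scaleN1r.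
rewrite !(bformDl, bformDr, bformZl, bformZr, dotDl, dotDr, dotZl, dotZr).
rewrite (bformC (offset k) om symM) (dotC om (offset k)).
by move=> h1 h2 h3 h4; split; lra.
Qed.

Lemma rigid_form k0 : h k0 != 0 -> dot om om = 4 /\
  exists2 t : R, t != 0 &
    forall p q, bform M p q = t * (dot p om * dot q om - 4 / 3 * dot p q).
Proof.
move=> h0; have [q0 n0 b0 m0] := support_offset h0.
(* A support reduced to [k0] and [kap - k0] would contradict [h_sum0]. *)
have [k1 [h1 k10 k10']] : exists k1, [/\ h k1 != 0, k1 != k0 & k1 != kap - k0].
  apply: contrapT => H; have := @sum_pair_neq0 S h k0 (kap - k0) (h k0) uniqS.
  rewrite h_sum0 eqxx => F; suff : false by [].
  apply: F => //; [exact: hS|exact/hS/h_sub|].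
  move=> l l0 l0'; apply/eqP; apply: contrapT => /negP hl; apply: H.
  by exists l.
have [q1 n1 b1 m1] := support_offset h1.
(* Both offsets have the same value under the metric and under [M], so their sum and difference are
   orthogonal for both forms. With [om] they make a frame diagonalizing the two at once. *)
pose ep := offset k0 + offset k1; pose em := offset k0 - offset k1.
have em0 : em != 0.
  by rewrite subr_eq0; apply: contraNneq k10 => /offset_inj ->.
have ep0 : ep != 0.
  rewrite /ep addr_eq0 -offset_sub eq_sym.
  by apply: contraNneq k10' => /offset_inj <-; rewrite opprB addrC subrK.
have epm : dot ep em = 0.
  rewrite /ep /em dotBr !dotDl n0 n1 (dotC (offset k1)).
  by ring.
have epo : dot ep om = 0 by rewrite dotDl q0 q1 addr0.
have emo : dot em om = 0 by rewrite dotBl q0 q1 subr0.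
have Mpm : bform M ep em = 0.
  rewrite /ep /em -scaleN1r !bformDr !bformZr !bformDl m0 m1.
  by rewrite (bformC (offset k1) (offset k0) symM); ring.
have Mpo : bform M ep om = 0 by rewrite bformC // bformDr b0 b1 addr0.
have Mmo : bform M em om = 0.
  by rewrite bformC // /em -scaleN1r bformDr bformZr b0 b1 mulr0 addr0.
have [pp mm] : dot ep ep != 0 /\ dot em em != 0 by rewrite !dot_eq0.
have off0 : offset k0 = 2^-1 *: (ep + em).
  by apply/rowP => i; rewrite !mxE; field.
clearbody ep em.
have prop : bform M ep ep * dot em em = bform M em em * dot ep ep.
  apply/eqP; apply: contrapT => /negP dne.
  pose al k := dot (offset k) ep / dot ep ep.
  pose be k := dot (offset k) em / dot em em.
  have dec k : h k != 0 -> offset k = al k *: ep + be k *: em.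
    move=> hk; have [qk _ _ _] := support_offset hk.
    rewrite {1}(orthogonal_triple (offset k) ep0 em0 om_neq0 epm epo emo).
    by rewrite qk mul0r scale0r addr0.
  have [al0 be0] : al k0 = 2^-1 /\ be k0 = 2^-1.
    rewrite /al /be off0 !dotZl !dotDl epm (dotC em ep) epm addr0 add0r.
    by rewrite !mulfK.
  (* The metric and [M] give two linear equations for the squared coordinates. Their determinant is
     nonzero by [dne], so the solution is the one known from [k0], and the support has at most the
     four sign patterns. *)
  have ab k : h k != 0 -> al k ^+ 2 = 4^-1 /\ be k ^+ 2 = 4^-1.
    move=> hk; have [_ nk _ mk] := support_offset hk.
    have E1 : al k ^+ 2 * dot ep ep + be k ^+ 2 * dot em em =
              4^-1 * dot ep ep + 4^-1 * dot em em.
      have : dot (offset k) (offset k) = dot (offset k0) (offset k0) by rewrite nk n0.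
      rewrite (dec k hk) (dec k0 h0) !(dotDl, dotDr, dotZl, dotZr).
      rewrite (dotC em ep) epm al0 be0.
      by move=> e; lra.
    have E2 : al k ^+ 2 * bform M ep ep + be k ^+ 2 * bform M em em =
              4^-1 * bform M ep ep + 4^-1 * bform M em em.
      have : bform M (offset k) (offset k) = bform M (offset k0) (offset k0).
        by rewrite mk m0.
      rewrite (dec k hk) (dec k0 h0) !(bformDl, bformDr, bformZl, bformZr).
      rewrite (bformC em ep symM) Mpm al0 be0.
      by move=> e; lra.
    rewrite -subr_eq0 in dne.
    split; apply/eqP; rewrite -subr_eq0; apply/eqP; apply: (mulIf dne); rewrite mul0r.
      transitivity (
        (al k ^+ 2 * bform M ep ep + be k ^+ 2 * bform M em em) * dot em em -
        (al k ^+ 2 * dot ep ep + be k ^+ 2 * dot em em) * bform M em em -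
        4^-1 * (bform M ep ep * dot em em - bform M em em * dot ep ep)).
        by ring.
      by rewrite E1 E2; ring.
    transitivity (
        (al k ^+ 2 * dot ep ep + be k ^+ 2 * dot em em) * bform M ep ep -
        (al k ^+ 2 * bform M ep ep + be k ^+ 2 * bform M em em) * dot ep ep -
        4^-1 * (bform M ep ep * dot em em - bform M em em * dot ep ep)).
      by ring.
    by rewrite E1 E2; ring.
  (* Pairing with [w] gives [al + be], which is 1 or -1 at the pair of [k0] and 0 at the two mixed
     sign patterns. The second moment along [w] thus isolates the pair of [k0] and contradicts
     [offset_sum2]. *)
  pose w := (dot ep ep)^-1 *: ep + (dot em em)^-1 *: em.
  have dw k : dot (offset k) w = al k + be k.
    by rewrite /w dotDr !dotZr mulrC [in LHS](mulrC _ (dot _ em)).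
  have := @sum_pair_neq0 S (fun k => h k * ((dot (offset k) w ^+ 2)%:C)%C)
     k0 (kap - k0) (h k0) uniqS.
  rewrite offset_sum2 eqxx => F; suff : false by [].
  have v0 : dot (offset k0) w ^+ 2 = 1 by rewrite dw al0 be0; field.
  apply: F => //; [exact: hS|exact/hS/h_sub| | |].
  - by rewrite v0 mulr1.
  - by rewrite offset_sub dotNl sqrrN v0 mulr1 h_sym.
  move=> l l0 l0'.
  have [->|hl] := eqVneq (h l) 0; first by rewrite mul0r.
  have [a2 b2] := ab l hl.
  rewrite dw; suff -> : al l + be l = 0 by rewrite expr0n /= mulr0.
  have : (al l - be l) * (al l + be l) = 0 by rewrite -subr_sqr a2 b2 subrr.
  move=> /eqP; rewrite mulf_eq0 => /orP[|/eqP //]; rewrite subr_eq0 => /eqP ab'.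
  have a4 : (al l - 2^-1) * (al l + 2^-1) = 0.
    by rewrite -subr_sqr a2; field.
  have oE : offset l = (al l * 2) *: offset k0.
    by rewrite (dec l hl) off0 -ab' -scalerDr scalerA; congr (_ *: _); field.
  move: a4 => /eqP; rewrite mulf_eq0 => /orP[|].
    rewrite subr_eq0 => /eqP aE; case/eqP: l0; apply: offset_inj.
    by rewrite oE aE mulVf ?scale1r // pnatr_eq0.
  rewrite addr_eq0 => /eqP aE; case/eqP: l0'; apply: offset_inj.
  by rewrite oE aE offset_sub mulNr mulVf ?scaleN1r // pnatr_eq0.
have [s [t E]] := diagonal_form symM ep0 em0 om_neq0 epm epo emo Mpm Mpo Mmo prop.
have nz : dot om om != 0 by rewrite dot_eq0 om_neq0.
(* This is the trace of $s\langle\cdot,\cdot\rangle + t\langle\cdot,\omega\rangle^2$. [Z] below is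
   the vanishing of the same form at [eta k0], whose product with [om] is $|\omega|^2/2$; comparing
   the two forces $|\omega|^2 = |\omega|^4/4$. *)
have T : 3 * s + t * dot om om = 0.
  rewrite -trM /mxtrace.
  have -> : \sum_i M i i = \sum_i (s + t * (om 0 i * om 0 i)).
    apply: eq_bigr => i _; rewrite -bform_delta E.
    have d1 : dot (delta_mx 0 i) om = om 0 i.
      by rewrite dotC /dot trmx_delta -colE mxE.
    by rewrite d1 /dot trmx_delta mul_delta_mx mxE !eqxx mulr1 -mulrA.
  rewrite big_split /= -mulr_sumr -dotE sumr_const card_ord.
  by rewrite mulr_natl.
have Z : 3 * s + t * (dot om om / 2) ^+ 2 = 0.
  have := hM h0; rewrite E h_sphere //.
  have -> : dot (eta k0) om = dot om om / 2.
    by rewrite eta_offset dotDl q0 dotZl addr0 mulrC.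
  by move=> <-; ring.
have t0 : t != 0.
  apply: contraNneq M_neq0 => t0.
  have s0 : s = 0.
    by move: T; rewrite t0 mul0r addr0 => /eqP; rewrite mulf_eq0 pnatr_eq0 => /eqP.
  by apply/eqP/matrixP => i j; rewrite -bform_delta E s0 t0 !mul0r addr0 mxE.
have om4 : dot om om = 4.
  have : t * dot om om * (dot om om - 4) = 0.
    transitivity (4 * ((3 * s + t * (dot om om / 2) ^+ 2) - (3 * s + t * dot om om))).
      by field.
    by rewrite T Z; ring.
  by move=> /eqP; rewrite !mulf_eq0 (negbTE t0) (negbTE nz) /= subr_eq0 => /eqP.
split=> //; exists t => // p q; rewrite E.
have -> : s = - (4 / 3 * t) by move: T; rewrite om4 => T'; lra.
by ring.
Qed.

End Rigidity.

(** * Rationality of the lattice *)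

Section Rationality.
Variables (R : realType) (B : 'M[R]_3).
Hypothesis unitB : B \in unitmx.
Implicit Types (k l : 'rV[int]_3) (X Y : 'M[rat]_3).

(** Gram matrix of the frequencies in their integer coordinates. *)
Definition dual_gram : 'M[R]_3 := (2 * pi) ^+ 2 *: ((invmx B)^T *m invmx B).

Lemma twopi_neq0 : 2 * pi != 0 :> R.
Proof. by rewrite mulf_neq0 // gt_eqF // pi_gt0. Qed.

Lemma dot_freqE k l :
  dot (freq B k) (freq B l) = bform dual_gram (map_mx intr k) (map_mx intr l).
Proof.
rewrite /freq dotZl dotZr mulrA -expr2 /bform /dual_gram -scalemxAr dotZl.
congr (_ * _).
by rewrite /dot !trmx_mul trmxK !mulmxA.
Qed.

Lemma gramE : gram B = (2 * pi) ^+ 2 *: invmx dual_gram.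
Proof.
have -> : gram B = B *m B^T.
  by apply/matrixP => i j; rewrite mxE dotE mxE; apply: eq_bigr => s _; rewrite !mxE.
have DG : dual_gram *m (B *m B^T) = ((2 * pi) ^+ 2)%:M.
  rewrite /dual_gram -scalemxAl mulmxA -(mulmxA _ (invmx B)) mulVmx // mulmx1.
  by rewrite -trmx_mul mulmxV // trmx1 scalemx1.
have uD : dual_gram \in unitmx.
  have : dual_gram *m (((2 * pi) ^+ 2)^-1 *: (B *m B^T)) = 1%:M.
    by rewrite -scalemxAr DG -scalemx1 scalerA mulVf ?scale1r // expf_neq0 // twopi_neq0.
  by case/mulmx1_unit.
by rewrite -[LHS](mulKmx uD) DG mul_mx_scalar.
Qed.

Definition rational_real (a : R) := exists q : rat, a = ratr q.

(** The Gram matrix of the lattice is $(2\pi)^2$ times the inverse of [dual_gram]; the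
    transcendental factor cancels in the ratios, and the rational reals are closed under the field
    operations. *)
Lemma gram_field_rational X : dual_gram = map_mx ratr X ->
  forall a, gram_field B a -> rational_real a.
Proof.
move=> DX a Ha.
have gq i j : gram B i j / gram B 0 0 = ratr (invmx X i j / invmx X 0 0).
  rewrite gramE DX -map_invmx !mxE fmorph_div.
  by rewrite -mulf_div divff ?mul1r // expf_neq0 // twopi_neq0.
pose S := [pred a : R | `[< rational_real a >]].
have Sq q : ratr q \in S by apply/asboolP; exists q.
have : a \in S.
  apply: Ha => [|b [i [j ->]]]; last by rewrite gq.
  split; first by apply/asboolP; exists 1; rewrite rmorph1.
  - by move=> x y /asboolP[p ->] /asboolP[q ->]; rewrite -rmorphB; exact: Sq.
  - by move=> x y /asboolP[p ->] /asboolP[q ->]; rewrite -fmorph_div; exact: Sq.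
by move/asboolP.
Qed.

(** Two rational numbers $q_0, q_1$ always satisfy a nontrivial relation: $q_1 q_0 - q_0 q_1 = 0$ if
    $q_0 \neq 0$, and $1 \cdot q_0 = 0$ otherwise. *)
Lemma dual_gram_irrational : irrational_torus B ->
  forall X, dual_gram <> map_mx ratr X.
Proof.
move=> [a Ka inda] X DX.
have [q0 E0] := gram_field_rational DX (Ka 0).
have [q1 E1] := gram_field_rational DX (Ka 1).
have [z0|nz0] := eqVneq q0 0.
  have := inda (fun i => (i == 0)%:R) _ 0; rewrite eqxx => F.
  suff /F/eqP : \sum_(i < 2) ratr ((i == 0)%:R) * a i = 0 by rewrite oner_eq0.
  rewrite !big_ord_recl big_ord0 /= E0 z0 !rmorph0 mulr0 mul0r.
  by rewrite !addr0.
have := inda (fun i => if i == 0 then q1 else - q0) _ 1; rewrite /= => F.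
suff /F/eqP : \sum_(i < 2) ratr (if i == 0 then q1 else - q0) * a i = 0.
  by rewrite oppr_eq0 (negbTE nz0).
rewrite !big_ord_recl big_ord0 /= E0.
have -> : lift ord0 ord0 = 1 :> 'I_2 by apply/val_inj.
by rewrite E1 rmorphN /= addr0 mulNr mulrC subrr.
Qed.

(* Over Q the linear system k X k^T = 3 (k in S) has the same solvability and
   the same kernel dimension as over R, and dual_gram is a real solution. *)
Lemma rational_cone (S : seq 'rV[int]_3) :
  (forall X, dual_gram <> map_mx ratr X) ->
  (forall k, k \in S -> dot (freq B k) (freq B k) = 3) ->
  exists X, [/\ X^T = X, X != 0 &
    forall k, k \in S -> (map_mx intr k *m X *m (map_mx intr k)^T) 0 0 = 0].
Proof.
move=> irr HS.
pose kv (s : 'I_(size S)) : 'rV[rat]_3 := map_mx intr (tnth (in_tuple S) s).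
(* Column [s] lists the entries of $k^T k$, so that [mxvec Z *m P] collects the values $k Z k^T$. *)
pose P : 'M[rat]_(3 * 3, size S) := \matrix_(a, s) (mxvec ((kv s)^T *m kv s)) 0 a.
have PE (F : fieldType) (f : {rmorphism rat -> F}) (Z : 'M[F]_3) s :
    (mxvec Z *m map_mx f P) 0 s = (map_mx f (kv s) *m Z *m (map_mx f (kv s))^T) 0 0.
  rewrite -mxvec_dotmul map_trmx -map_mxM -map_mxvec.
  rewrite mxE [RHS]mxE; apply: eq_bigr => a _.
  by rewrite mulrC [P]lock !mxE -lock mxE.
have PE1 (Z : 'M[rat]_3) s : (mxvec Z *m P) 0 s = (kv s *m Z *m (kv s)^T) 0 0.
  by have := PE _ (@idfun rat) Z s; rewrite !map_mx_id.
have kvR s : map_mx ratr (kv s) = map_mx intr (tnth (in_tuple S) s) :> 'rV[R]_3.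
  by apply/rowP => i; rewrite !mxE ratr_int.
have sol : mxvec dual_gram *m map_mx ratr P = map_mx ratr (const_mx 3%:R : 'rV_(size S)).
  apply/rowP => s; rewrite PE kvR.
  have := HS _ (mem_tnth s (in_tuple S)); rewrite dot_freqE /bform /dot => ->.
  by rewrite !mxE rmorph_nat.
(* Membership in a row space is unaffected by field extension, so the real solution yields a
   rational one, not necessarily symmetric. *)
have /submxP[x0 Ex0] : ((const_mx 3%:R : 'rV[rat]_(size S)) <= P)%MS.
  by rewrite -(map_submx (@ratr R)) -sol submxMl.
pose X0 := vec_mx x0.
pose Y := dual_gram - map_mx ratr X0.
have symD : dual_gram^T = dual_gram by rewrite /dual_gram linearZ /= trmx_mul trmxK.
have Yker : (mxvec Y <= map_mx ratr (kermx P))%MS.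
  rewrite map_kermx; apply/sub_kermxP.
  rewrite /Y linearB /= mulmxBl sol Ex0 map_mxM -map_mxvec vec_mxK.
  by rewrite subrr.
have [|H] := pselect (exists i,
  vec_mx (row i (kermx P)) + (vec_mx (row i (kermx P)))^T != 0).
  case=> i Hi; exists (vec_mx (row i (kermx P)) + (vec_mx (row i (kermx P)))^T).
  split=> //; first by rewrite linearD /= trmxK addrC.
  move=> k kS; have /tnthP[s kE] : k \in in_tuple S by [].
  have := PE1 (vec_mx (row i (kermx P))) s.
  rewrite vec_mxK -row_mul mulmx_ker row0 mxE /kv -kE => /esym Z0.
  rewrite mulmxDr mulmxDl mxE Z0 add0r.
  by rewrite -[RHS]Z0 -[in RHS]trace_mx11 -mxtrace_tr !trmx_mul trmxK mulmxA trace_mx11.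
(* If every rational kernel vector were antisymmetric, so would be [Y], which lies in the real span
   of the kernel. Then [dual_gram] would be the symmetric part of the rational matrix [X0]. *)
exfalso.
have symY : Y + Y^T = 0.
  have /submxP[w Ew] := Yker.
  have -> : Y = vec_mx (w *m map_mx ratr (kermx P)) by rewrite -Ew mxvecK.
  rewrite mulmx_sum_row linear_sum /= linear_sum /= -big_split /= big1 // => i _.
  rewrite !linearZ /= -scalerDr -map_row -map_vec_mx map_trmx -map_mxD.
  have -> : vec_mx (row i (kermx P)) + (vec_mx (row i (kermx P)))^T = 0.
    by apply/eqP; apply: contrapT => /negP nz; apply: H; exists i.
  by rewrite map_mx0 scaler0.
apply: (irr (2^-1 *: (X0 + X0^T))).
rewrite map_mxZ map_mxD -map_trmx fmorphV rmorph_nat.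
have : dual_gram + dual_gram = map_mx ratr X0 + (map_mx ratr X0)^T.
  apply/eqP; rewrite -subr_eq0 opprD addrACA -{2}symD -linearN /= -linearD /=.
  by rewrite symY.
move=> <-; rewrite scalerDr -scalerDl [_ + _](_ : _ = 1) ?scale1r //.
by field.
Qed.

(** The form on Euclidean space that takes the rational values of [X] on the frequencies. *)
Definition pullback X : 'M[R]_3 := ((2 * pi) ^+ 2)^-1 *: (B^T *m map_mx ratr X *m B).

Lemma pullback_freq X k l :
  bform (pullback X) (freq B k) (freq B l) =
  ratr ((map_mx intr k *m X *m (map_mx intr l)^T) 0 0).
Proof.
have iE (j : 'rV[int]_3) : map_mx intr j = map_mx ratr (map_mx intr j) :> 'rV[R]_3.
  by apply/rowP => i; rewrite !mxE ratr_int.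
rewrite /freq /pullback bformZl bformZr mulrA -expr2 /bform -scalemxAr dotZl.
rewrite mulrA divff ?mul1r ?expf_neq0 ?twopi_neq0 //.
rewrite /dot trmx_mul trmxK !mulmxA -(mulmxA _ (invmx B)^T) -trmx_mul mulmxV //.
rewrite trmx1 mulmx1 -(mulmxA _ B) mulmxV // mulmx1.
by rewrite !iE [in LHS]map_trmx -!map_mxM mxE.
Qed.

Lemma pullback_neq0 X : X != 0 -> pullback X != 0.
Proof.
apply: contra_neq => E; apply/matrixP => i j.
have := pullback_freq X (delta_mx 0 i) (delta_mx 0 j).
rewrite E /bform mulmx0 dot0l !map_delta_mx -rowE trmx_delta -colE !mxE.
by move=> /esym/eqP; rewrite fmorph_eq0 => /eqP.
Qed.

(** The values of the form are rational at frequencies. At [(kap, kap)] it equals $(16 - 16/3)t$, so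
    [t] is rational; at [(k, kap)] it is $(8/3)t$ times the inner product; at [(k, l)] the only
    unknown left is the inner product of [k] and [l]. *)
Lemma rigid_form_rational X kap (t : R) : t != 0 ->
  dot (freq B kap) (freq B kap) = 4 ->
  (forall p q, bform (pullback X) p q = t * (dot p (freq B kap) * dot q (freq B kap)
     - 4 / 3 * dot p q)) ->
  exists Y, dual_gram = map_mx ratr Y.
Proof.
move=> t0 om4 E; pose x k l := (map_mx intr k *m X *m (map_mx intr l)^T) 0 0.
have tE : t = ratr (3 / 32 * x kap kap).
  have := E (freq B kap) (freq B kap); rewrite pullback_freq om4 -/(x kap kap).
  by rewrite rmorphM fmorph_div !rmorph_nat => /= ->; field.
have xE k : dot (freq B k) (freq B kap) = ratr (3 / 8 * x k kap / (3 / 32 * x kap kap)).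
  have := E (freq B k) (freq B kap); rewrite pullback_freq om4 -/(x k kap).
  rewrite fmorph_div /= -tE rmorphM fmorph_div !rmorph_nat => /= ->.
  by field.
have xkE k l : rational_real (dot (freq B k) (freq B l)).
  have := E (freq B k) (freq B l); rewrite pullback_freq -/(x k l) => e.
  exists (3 / 4 * ((3 / 8 * x k kap / (3 / 32 * x kap kap)) *
     (3 / 8 * x l kap / (3 / 32 * x kap kap)) - x k l / (3 / 32 * x kap kap))).
  rewrite rmorphM rmorphB /= [ratr (_ * (3 / 8 * x l kap / _))]rmorphM /= -!xE.
  rewrite [ratr (x k l / _)]fmorph_div /= -tE e fmorph_div !rmorph_nat /=.
  by field.
have /choice[q qE] : forall ij : 'I_3 * 'I_3, exists q : rat,
    dot (freq B (delta_mx 0 ij.1)) (freq B (delta_mx 0 ij.2)) = ratr q.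
  by move=> ij; exact: xkE.
exists (\matrix_(i, j) q (i, j)); apply/matrixP => i j.
rewrite [RHS]mxE [X in ratr X]mxE -qE /=.
by rewrite dot_freqE !map_delta_mx bform_delta.
Qed.

End Rationality.

(** * Extension to an orthogonal matrix *)

Section OrthogonalExtension.
Variables (R : realType) (m : nat).
Implicit Types (g : 'M[R]_m) (x y z w : 'rV[R]_m).

Lemma dot_mulmx_orthogonal g x y : g *m g^T = 1%:M -> dot (x *m g) (y *m g) = dot x y.
Proof. by move=> gg; rewrite /dot trmx_mul mulmxA -(mulmxA x) gg mulmx1. Qed.

Definition reflection w : 'M[R]_m := 1%:M - (2 / dot w w) *: (w^T *m w).

Lemma mul_reflection z w : z *m reflection w = z - (2 / dot w w * dot z w) *: w.
Proof.
rewrite /reflection mulmxBr mulmx1 -scalemxAr mulmxA.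
by rewrite [z *m _]mx11_scalar mul_scalar_mx scalerA.
Qed.

Lemma reflection_orthogonal w : w != 0 -> reflection w *m (reflection w)^T = 1%:M.
Proof.
move=> w0; have ww : dot w w != 0 by rewrite dot_eq0.
have -> : (reflection w)^T = reflection w.
  by rewrite /reflection linearB /= trmx1 linearZ /= trmx_mul trmxK.
apply/row_matrixP => i; rewrite row_mul !mul_reflection rowE mul_reflection.
rewrite row1 dotBl dotZl; apply/rowP => j; rewrite !mxE.
by field.
Qed.

Lemma reflection_swap x y : dot x x = dot y y -> x != y ->
  x *m reflection (y - x) = y.
Proof.
move=> xy nxy; have w0 : dot (y - x) (y - x) != 0.
  by rewrite dot_eq0 subr_eq0 eq_sym.
have E : dot (y - x) (y - x) = - 2 * dot x (y - x).
  by rewrite !dotBr !dotBl (dotC y x) -xy; ring.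
rewrite mul_reflection.
have -> : 2 / dot (y - x) (y - x) * dot x (y - x) = -1.
  move: w0; rewrite E mulf_eq0 negb_or => /andP[_ d0].
  by field.
by rewrite scaleN1r opprK addrC subrK.
Qed.

(** The vectors are matched one by one. A reflection sends [X a *m g] to [Y a], and it fixes each
    [Y i] already matched, since equal Gram data make [Y i] orthogonal to [Y a - X a *m g]. *)
Lemma orthogonal_family p (X Y : 'I_p -> 'rV[R]_m) :
  (forall i j, dot (X i) (X j) = dot (Y i) (Y j)) ->
  exists2 g, g *m g^T = 1%:M & forall i, Y i = X i *m g.
Proof.
move=> XY.
suff H n : exists2 g, g *m g^T = 1%:M & forall i : 'I_p, (i < n)%N -> Y i = X i *m g.
  by have [g gg Hg] := H p; exists g => // i; exact: Hg.
elim: n => [|n [g gg Hg]]; first by exists 1%:M => //; rewrite trmx1 mulmx1.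
have [pn|np] := leqP p n.
  by exists g => // i _; apply: Hg; exact: leq_trans (ltn_ord i) pn.
pose a := Ordinal np.
have [E|nE] := eqVneq (X a *m g) (Y a).
  exists g => // i; rewrite ltnS leq_eqVlt => /orP[/eqP ia|]; last exact: Hg.
  by have -> : i = a by exact/val_inj.
have w0 : Y a - X a *m g != 0 by rewrite subr_eq0 eq_sym.
exists (g *m reflection (Y a - X a *m g)).
  rewrite trmx_mul mulmxA -(mulmxA g) reflection_orthogonal //.
  by rewrite mulmx1.
move=> i; rewrite ltnS leq_eqVlt mulmxA => /orP[/eqP ia|lt_in].
  have -> : i = a by exact/val_inj.
  by apply/esym/reflection_swap => //; rewrite dot_mulmx_orthogonal // XY.
have z0 : dot (Y i) (Y a - X a *m g) = 0.
  by rewrite dotBr {2}(Hg i lt_in) dot_mulmx_orthogonal // XY subrr.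
by rewrite mul_reflection -(Hg i lt_in) z0 mulr0 scale0r subr0.
Qed.

(** A finite family that does not span can be enlarged with strictly larger rank, and the rank is at
    most [m]. *)
Lemma spanning_family (T : Type) (x : T -> 'rV[R]_m) :
  exists p (sg : 'I_p -> T), forall s, (x s <= \matrix_i x (sg i))%MS.
Proof.
pose spans p (sg : 'I_p -> T) := forall s, (x s <= \matrix_i x (sg i))%MS.
have H k : (exists p (sg : 'I_p -> T), spans p sg) \/
    (exists p (sg : 'I_p -> T), (k <= \rank (\matrix_i x (sg i)))%N).
  elim: k => [|k [|[p [sg Hk]]]]; [|by left|].
    by right; exists 0%N, (fun i : 'I_0 => False_rect T (notF (ltn_ord i))).
  have [Hs|/existsNP[s /negP ns]] := pselect (spans p sg); first by left; exists p, sg.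
  right; exists p.+1, (fun i => if unlift ord0 i is Some j then sg j else s).
  apply: leq_ltn_trans Hk _; apply: rank_ltmx; rewrite ltmxE; apply/andP; split.
    apply/row_subP => i; rewrite rowK.
    by apply: (eq_row_sub (lift ord0 i)); rewrite rowK liftK.
  apply: contra ns; apply: submx_trans.
  by apply: (eq_row_sub ord0); rewrite rowK unlift_none.
have [//|[p [sg]]] := H m.+1.
by rewrite ltnNge rank_leq_col.
Qed.

(** After matching a finite spanning family, a linear relation among the [x s] transfers to the
    [y s]: the squared norm of the defect is a polynomial in inner products, which agree. *)
Lemma orthogonal_extension (T : Type) (x y : T -> 'rV[R]_m) :
  (forall s t, dot (x s) (x t) = dot (y s) (y t)) ->
  exists2 g, g *m g^T = 1%:M & forall s, y s = x s *m g.
Proof.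
move=> xy; have [p [sg Hsg]] := spanning_family x.
have [g gg Hg] := @orthogonal_family p (x \o sg) (y \o sg) (fun i j => xy _ _).
exists g => // s; have /submxP[c Ec] := Hsg s.
have xE : x s = \sum_i c 0 i *: x (sg i).
  by rewrite Ec mulmx_sum_row; apply: eq_bigr => i _; rewrite rowK.
suff yE : y s = \sum_i c 0 i *: y (sg i).
  rewrite yE xE mulmx_suml; apply: eq_bigr => i _.
  by rewrite -scalemxAl -Hg.
apply/eqP; rewrite -subr_eq0 -dot_eq0.
have dot_diff (z : T -> 'rV[R]_m) :
    dot (z s - \sum_i c 0 i *: z (sg i)) (z s - \sum_i c 0 i *: z (sg i)) =
    dot (z s) (z s) - 2 * (\sum_i c 0 i * dot (z (sg i)) (z s)) +
    \sum_i c 0 i * (\sum_j c 0 j * dot (z (sg i)) (z (sg j))).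
  set w := \sum_i c 0 i *: z (sg i).
  have ws t : dot w (z t) = \sum_i c 0 i * dot (z (sg i)) (z t).
    by rewrite /w dot_suml; apply: eq_bigr => i _; rewrite dotZl.
  have ww : dot w w = \sum_i c 0 i * (\sum_j c 0 j * dot (z (sg i)) (z (sg j))).
    rewrite {1}/w dot_suml; apply: eq_bigr => i _; rewrite dotZl dotC ws.
    by congr (_ * _); apply: eq_bigr => j _; rewrite dotC.
  by rewrite dotBl !dotBr (dotC (z s) w) ws ww; ring.
rewrite dot_diff -xy; under eq_bigr do rewrite -xy.
under [X in _ + X]eq_bigr do under eq_bigr do rewrite -xy.
by rewrite -dot_diff -xE subrr dot0l.
Qed.

End OrthogonalExtension.

(** * Minimal immersions *)

Section Coordinates.
Variables (R : realType) (n m : nat).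
Implicit Types (f : 'rV[R]_n.+1 -> 'rV[R]_m.+1).

Lemma class_C_dC k f j : class_C k f -> dC k (fun p => f p 0 j).
Proof.
have cc g : continuous g -> continuous (fun p : 'rV[R]_n.+1 => (g p : 'rV[R]_m.+1) 0 j).
  move=> cg p; apply: (@continuous_comp _ _ _ g (fun y : 'rV[R]_m.+1 => y 0 j)).
    exact: cg.
  exact: coord_continuous.
elim: k f => [|k IH] f; first by move=> cf; split=> //; exact: cc.
move=> [df Df].
have der p v : derivable f p v by exact: diff_derivable.
split; first by apply: cc => p; exact: differentiable_continuous.
split=> [p v|v]; first exact: ((derivable_mxP _ _ _).1 (der p v) 0 j).
apply: dC_ext (IH _ (Df v)) => p.
by rewrite derive_mx // mxE.
Qed.

Lemma smooth_derive f v : smooth f -> smooth ('D_v f).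
Proof. by move=> sf k; have [_] := sf k.+1; apply. Qed.

Lemma smooth_derivable f p v : smooth f -> derivable f p v.
Proof. by move=> sf; have [df _] := sf 1%N; exact: diff_derivable. Qed.

Lemma derive_coord f p v j : smooth f ->
  'D_v (fun q => f q 0 j) p = ('D_v f p) 0 j.
Proof. by move=> sf; rewrite derive_mx ?mxE //; exact: smooth_derivable. Qed.

Lemma derive_dot f g p v : smooth f -> smooth g ->
  'D_v (fun q => dot (f q) (g q)) p = dot ('D_v f p) (g p) + dot (f p) ('D_v g p).
Proof.
move=> sf sg.
have df j : derivable (fun q => f q 0 j) p v.
  exact: dC_derivable (class_C_dC j (sf 1%N)).
have dg j : derivable (fun q => g q 0 j) p v.
  exact: dC_derivable (class_C_dC j (sg 1%N)).
have -> : (fun q => dot (f q) (g q)) = \sum_j (fun q => f q 0 j * g q 0 j).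
  by apply/funext => q; rewrite dotE fct_sumE.
rewrite derive_sum => [|j]; last exact: derivableM.
rewrite !dotE -big_split /=; apply: eq_bigr => j _.
by rewrite deriveME // !derive_coord.
Qed.

Lemma derive_dot_cst f g (c : R) p v : smooth f -> smooth g ->
  (forall q, dot (f q) (g q) = c) ->
  dot ('D_v f p) (g p) + dot (f p) ('D_v g p) = 0.
Proof.
move=> sf sg fg; rewrite -derive_dot // -[RHS](derive_cst c p v).
by congr ('D_v _ p); apply/funext.
Qed.

End Coordinates.

Section MinimalImmersion.
Variables (R : realType) (m : nat) (B : 'M[R]_3) (x : 'rV[R]_3 -> 'rV[R]_m.+1).
Hypothesis unitB : B \in unitmx.
Hypothesis immx : isometric_immersion B x.
Hypothesis minx : minimal x.

Local Notation sx := (immersion_smooth immx).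

Definition to_complex (f : 'rV[R]_3 -> R) u : R[i] := (f u)%:C%C.

Lemma to_complex_cdC k f : dC k f -> cdC k (to_complex f).
Proof. by move=> Hf; split=> //; exact: dC_cst. Qed.

Lemma cderive_to_complex f v u :
  cderive v (to_complex f) u = to_complex ('D_v f) u.
Proof. by apply: complex_ext => //=; rewrite (derive_cst (0 : R)). Qed.

Lemma to_complex_periodic f : periodic_fun B f -> periodic_fun B (to_complex f).
Proof. by move=> pf l Hl p; rewrite /to_complex pf. Qed.

(* Both orders of differentiation multiply the Fourier coefficients by the same
   factor. *)
Lemma cderive_comm_periodic (F : 'rV[R]_3 -> R[i]) u v w :
  cdC 3 F -> periodic_fun B F ->
  cderive v (cderive w F) u = cderive w (cderive v F) u.
Proof.
move=> HF pF.
have H2 a : cdC 2 (cderive a F) := cdC_derive a HF.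
have H1 a b : cdC 1 (cderive a (cderive b F)) := cdC_derive a (H2 b).
have fc k a b : fcoef B k (cderive a (cderive b F)) =
    'i%C * (dot (freq B k) a)%:C%C * ('i%C * (dot (freq B k) b)%:C%C * fcoef B k F).
  rewrite fcoef_derive //; [|exact: cdCW|exact: cderive_periodic].
  by rewrite fcoef_derive //; exact/cdCW/cdCW.
pose G u := cderive v (cderive w F) u + (-1) * cderive w (cderive v F) u.
have HG : cdC 1 G by apply: cdC_add => //; apply: cdC_mul => //; exact: cdC_cst.
have pG : periodic_fun B G.
  have pDD a b : periodic_fun B (cderive a (cderive b F)).
    exact/cderive_periodic/cderive_periodic.
  by move=> l Hl p; rewrite /G !(pDD _ _ l Hl).
have G0 : G u = 0.
  apply: (fcoef_eq0 unitB HG pG) => k.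
  rewrite fcoefD; [|exact/cdCW/H1|]; last first.
    by apply: cdC_mul; [exact: cdC_cst|exact/cdCW/H1].
  rewrite fcoefZ; last exact/cdCW/H1.
  rewrite [X in X + _]fc [X in _ + _ * X]fc.
  by rewrite mulN1r mulrCA subrr.
by move: G0; rewrite /G mulN1r => /eqP; rewrite subr_eq0 => /eqP.
Qed.

Lemma derive_comm_periodic f u v w : dC 3 f -> periodic_fun B f ->
  'D_v ('D_w f) u = 'D_w ('D_v f) u.
Proof.
move=> Hf pf; have E a b : cderive a (cderive b (to_complex f)) u =
    to_complex ('D_a ('D_b f)) u.
  rewrite -cderive_to_complex; congr (cderive a _ u); apply/funext => q.
  exact: cderive_to_complex.
have := cderive_comm_periodic u v w (to_complex_cdC Hf) (to_complex_periodic pf).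
by rewrite !E => /(congr1 (@complex.Re R)).
Qed.

Lemma coord_periodic j : periodic_fun B (fun p => x p 0 j).
Proof. by move=> l Hl p; rewrite (immersion_periodic immx). Qed.

Lemma derive2_coord u v p j :
  ('D_u ('D_v x) p) 0 j = 'D_u ('D_v (fun q => x q 0 j)) p.
Proof.
rewrite -derive_coord; last exact: (smooth_derive v sx).
by congr ('D_u _ p); apply/funext => q; rewrite derive_coord //; exact: sx.
Qed.

Lemma derive_commx u v p : 'D_u ('D_v x) p = 'D_v ('D_u x) p.
Proof.
apply/rowP => j; rewrite [LHS]derive2_coord [RHS]derive2_coord.
apply: derive_comm_periodic.
  exact: class_C_dC (sx 3%N).
exact: coord_periodic.
Qed.

(** The vector $\partial_i\partial_i x$ has product -1 with $x$ and is orthogonal to the tangent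
    space, so its normal part is $\partial_i\partial_i x + x$. Minimality makes the sum of the three
    normal parts vanish. *)
Lemma laplacian_immersion p :
  \sum_i 'D_(frame R i) ('D_(frame R i) x) p = - 3 *: x p.
Proof.
pose e := frame R; pose D i := 'D_(e i) x.
have sD i : smooth (D i) by exact: (smooth_derive (e i) sx).
have dx1 q i : dot (D i q) (x q) = 0.
  have := derive_dot_cst q (e i) sx sx (immersion_sphere immx).
  by rewrite (dotC (x q)) -/(D i) => h; lra.
have DD q i : dot ('D_(e i) (D i) q) (x q) = - 1.
  have := derive_dot_cst q (e i) (sD i) sx (fun q => dx1 q i).
  rewrite (immersion_isometric immx) /e /frame.
  have -> : dot (delta_mx 0 i) (delta_mx 0 i) = 1 :> R.
    by rewrite /dot trmx_delta mul_delta_mx mxE !eqxx.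
  by move=> h; lra.
have lin (a b c d : R) : a + b = 0 -> c + d = 0 -> b = d -> d = c -> a = 0.
  by move=> ab cd bd dc; lra.
(* Moving one derivative over and commuting gives $-\langle \partial_i x, \partial_l\partial_i
   x\rangle$, which is zero since $|\partial_i x|$ is constant. *)
have DT q i l : dot ('D_(e i) (D i) q) (D l q) = 0.
  have h1 := derive_dot_cst q (e i) (sD i) (sD l)
    (fun q => immersion_isometric immx q (e i) (e l)).
  have h2 := derive_dot_cst q (e l) (sD i) (sD i)
    (fun q => immersion_isometric immx q (e i) (e i)).
  have E : 'D_(e i) (D l) q = 'D_(e l) (D i) q by exact: derive_commx.
  exact: lin h1 h2 (congr1 (dot (D i q)) E) (dotC _ _).
have NP i : second_fundamental_form x p (e i) (e i) = 'D_(e i) (D i) p + x p.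
  rewrite /second_fundamental_form /normal_part DD.
  rewrite big1 => [|l _]; last by rewrite DT scale0r.
  by rewrite subr0 scaleN1r opprK.
have := minx p; rewrite /mean_curvature => /eqP.
rewrite scaler_eq0 invr_eq0 pnatr_eq0 /= => /eqP.
rewrite (eq_bigr _ (fun i _ => NP i)) big_split /= sumr_const card_ord.
move=> /eqP; rewrite addr_eq0 => /eqP ->.
by rewrite scaleNr -scaler_nat.
Qed.

Lemma laplacian_coord p j :
  \sum_i 'D_(frame R i) ('D_(frame R i) (fun q => x q 0 j)) p = - 3 * x p 0 j.
Proof.
under eq_bigr do rewrite -derive2_coord.
by have := congr1 (fun y : 'rV_m.+1 => y 0 j) (laplacian_immersion p);
  rewrite summxE mxE.
Qed.

End MinimalImmersion.

(** * Laplace eigenfunctions *)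

Section TrigonometricSums.
Variables (R : realType) (B : 'M[R]_3).
Hypothesis unitB : B \in unitmx.
Local Notation C := R[i].
Local Notation V := 'rV[R]_3.
Local Notation ph k := (phase (freq B k)).

Lemma freq_sphere_finite (r : R) : exists2 S : seq 'rV[int]_3, uniq S &
  forall k, (k \in S) = (dot (freq B k) (freq B k) == r).
Proof.
pose bd i : R := (1 + r) * \sum_j `|row i B 0 j|.
pose N := Num.bound (\sum_i `|bd i|).
have bound k : dot (freq B k) (freq B k) = r -> forall i, (absz (k 0%R i) <= N)%N.
  move=> kr i.
  (* For $a \ge 0$ with $a^2 \le r$, $(a-1)^2 \ge 0$ gives $a \le 2a \le 1 + r$, a bound without
     square roots. *)
  have coord j : `|freq B k 0 j| <= 1 + r.
    have : freq B k 0 j ^+ 2 <= r.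
      rewrite -kr dotE (bigD1 j) //= -expr2 lerDl sumr_ge0 // => l _.
      by rewrite -expr2 sqr_ge0.
    rewrite -real_normK ?num_real // => h.
    have := sqr_ge0 (`|freq B k 0 j| - 1); rewrite sqrrB1 => h'.
    have := normr_ge0 (freq B k 0 j); move: h h'.
    by move: `|freq B k 0 j| => a; rewrite expr2; nra.
  have E := dot_freq_basis unitB k i.
  have le1 : `|2 * pi * (k 0 i)%:~R| <= bd i.
    rewrite -E dotE (le_trans (ler_norm_sum _ _ _)) // /bd mulr_sumr.
    by apply: ler_sum => j _; rewrite normrM ler_wpM2r.
  have le2 : `|(k 0 i)%:~R| <= `|2 * pi * (k 0 i)%:~R| :> R.
    rewrite normrM ler_peMl // ger0_norm; last by rewrite mulr_ge0 // pi_ge0.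
    by have := @pi_ge2 R; lra.
  have lt3 : `|(k 0 i)%:~R| < N%:R :> R.
    apply: le_lt_trans (le_trans le2 le1) _.
    apply: (@le_lt_trans _ _ (\sum_i `|bd i|)).
      rewrite (bigD1 i) //= (le_trans (ler_norm _)) // lerDl sumr_ge0 // => l _.
    by apply: archi_boundP; rewrite sumr_ge0.
  move: lt3; rewrite -intr_norm -[N%:R]/((N%:Z)%:~R) ltr_int.
  by rewrite -abszE ltz_nat => /ltnW.
(* Enumerates the integer box $[-N, N]^3$ by shifting values in $[0, 2N]$. *)
pose dec (f : {ffun 'I_3 -> 'I_(N + N).+1}) : 'rV[int]_3 :=
  \row_i ((f i)%:Z - N%:Z).
exists (undup [seq k <- [seq dec f | f <- enum {: {ffun 'I_3 -> 'I_(N + N).+1}}]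
                  | dot (freq B k) (freq B k) == r]).
  exact: undup_uniq.
move=> k; rewrite mem_undup mem_filter.
have [kr|//] := eqVneq (dot (freq B k) (freq B k)) r.
apply/mapP; exists [ffun i => inord (absz (k 0 i + N%:Z))]; first by rewrite mem_enum.
apply/rowP => i; rewrite mxE ffunE.
have ki := bound k kr i.
move: (k 0 i) ki => a ha; rewrite inordK; last by move: ha; case: a => n; lia.
by rewrite gez0_abs ?addrK //; move: ha; case: a => n; lia.
Qed.

Lemma cdC_phase_sum n (S : seq 'rV[int]_3) (p : 'rV[int]_3 -> C) :
  cdC n (fun u : V => \sum_(k <- S) p k * ph k u).
Proof.
by apply: cdC_sum => k; apply: cdC_mul; [exact: cdC_cst|exact: phase_cdC].
Qed.

Lemma fcoef_phase_sum (S : seq 'rV[int]_3) (p : 'rV[int]_3 -> C) k : uniq S ->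
  fcoef B k (fun u => \sum_(l <- S) p l * ph l u) = if k \in S then p k else 0.
Proof.
move=> uS; rewrite fcoef_sum => [|l]; last first.
  by apply: cdC_mul; [exact: cdC_cst|exact: phase_cdC].
have E l : fcoef B k (fun u => p l * ph l u) = p l * (k == l)%:R.
  by rewrite fcoefZ ?fcoef_phase //; exact: phase_cdC.
rewrite (eq_bigr _ (fun l _ => E l)); case: ifPn => kS.
  rewrite (bigD1_seq k) //= eqxx mulr1 big1 ?addr0 // => l.
  by rewrite eq_sym => /negbTE ->; rewrite mulr0.
rewrite big_seq big1 // => l lS; case: eqVneq => [kl|_]; last exact: mulr0.
by rewrite kl lS in kS.
Qed.

(** Coefficients of a product are convolved. Since [k - l] can leave [S], the function [q] has to
    vanish there. *)
Lemma fcoef_prod (S : seq 'rV[int]_3) (p q : 'rV[int]_3 -> C) k : uniq S ->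
  (forall l, l \notin S -> q l = 0) ->
  fcoef B k (fun u => (\sum_(l <- S) p l * ph l u) * (\sum_(l <- S) q l * ph l u))
  = \sum_(l <- S) p l * q (k - l).
Proof.
move=> uS q0.
have -> : (fun u => (\sum_(l <- S) p l * ph l u) * (\sum_(l <- S) q l * ph l u)) =
    fun u => \sum_(l <- S) p l * \sum_(l' <- S) q l' * ph (l + l') u.
  apply/funext => u; rewrite mulr_suml; apply: eq_bigr => l _.
  rewrite -mulrA mulr_sumr; congr (_ * _); apply: eq_bigr => l' _.
  by rewrite freqD phaseD mulrCA.
have cs l : cdC 0 (fun u : V => \sum_(l' <- S) q l' * ph (l + l') u).
  by apply: cdC_sum => l'; apply: cdC_mul; [exact: cdC_cst|exact: phase_cdC].
rewrite fcoef_sum => [|l]; last by apply: cdC_mul; [exact: cdC_cst|exact: cs].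
apply: eq_bigr => l _; rewrite fcoefZ; last exact: cs.
congr (_ * _); rewrite fcoef_sum => [|l']; last first.
  by apply: cdC_mul; [exact: cdC_cst|exact: phase_cdC].
have E l' : fcoef B k (fun u => q l' * ph (l + l') u) = q l' * (k - l == l')%:R.
  rewrite fcoefZ; last exact: phase_cdC.
  by rewrite fcoef_phase // subr_eq addrC.
rewrite (eq_bigr _ (fun l' _ => E l')).
have [kS|kS] := boolP (k - l \in S).
  rewrite (bigD1_seq (k - l)) //= eqxx mulr1 big1 ?addr0 // => l'.
  by rewrite eq_sym => /negbTE ->; rewrite mulr0.
rewrite q0 // big_seq big1 // => l' lS; case: eqVneq => [kl|_]; last exact: mulr0.
by rewrite kl lS in kS.
Qed.

Lemma fcoef_dot n (S : seq 'rV[int]_3) (p q : 'rV[int]_3 -> 'I_n -> C) k :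
  uniq S -> (forall l j, l \notin S -> q l j = 0) ->
  fcoef B k (fun u => \sum_j (\sum_(l <- S) p l j * ph l u) *
                              (\sum_(l <- S) q l j * ph l u))
  = \sum_(l <- S) \sum_j p l j * q (k - l) j.
Proof.
move=> uS q0; rewrite fcoef_sum => [|j].
  rewrite exchange_big; apply: eq_bigr => j _.
  by rewrite (@fcoef_prod _ (p^~ j) (q^~ j)) // => l; exact: q0.
by apply: cdC_mul; exact: (@cdC_phase_sum 0 S (_^~ j)).
Qed.

Lemma fcoef_cst k (z : C) : fcoef B k (fun=> z) = z * (k == 0)%:R.
Proof.
have -> : (fun _ : V => z) = fun u => z * ph 0 u.
  by apply/funext => u; rewrite freq0 phase0l mulr1.
by rewrite fcoefZ; [rewrite fcoef_phase|exact: phase_cdC].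
Qed.

Lemma cderive_phase_sum (S : seq 'rV[int]_3) (p : 'rV[int]_3 -> C) u v :
  cderive v (fun u : V => \sum_(k <- S) p k * ph k u) u =
  \sum_(k <- S) ('i%C * (dot (freq B k) v)%:C%C * p k) * ph k u.
Proof.
rewrite cderive_sum => [|k]; last first.
  by apply: cdC_mul; [exact: cdC_cst|exact: phase_cdC].
apply: eq_bigr => k _; rewrite cderiveZ; last exact: phase_cdC.
by rewrite cderive_phase; ring.
Qed.

Section Eigenfunction.
Variables (F : V -> C) (lam : R) (S : seq 'rV[int]_3).
Hypothesis HF : cdC 2 F.
Hypothesis pF : periodic_fun B F.
Hypothesis eigF : forall u,
  \sum_i cderive (frame R i) (cderive (frame R i) F) u = (- lam)%:C%C * F u.
Hypothesis uniqS : uniq S.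
Hypothesis memS : forall k, (k \in S) = (dot (freq B k) (freq B k) == lam).

Lemma dot_frame (w : V) i : dot w (frame R i) = w 0 i.
Proof. by rewrite /dot /frame trmx_delta -colE mxE. Qed.

(** The Laplacian multiplies the coefficient at [k] by $-|\eta_k|^2$, the eigenvalue equation by
    $-\lambda$; off [S] the two factors differ. *)
Lemma fcoef_eigen k : k \notin S -> fcoef B k F = 0.
Proof.
rewrite memS => kS.
have H1 i : cdC 1 (cderive (frame R i) F) := cdC_derive (frame R i) HF.
have Di i : fcoef B k (cderive (frame R i) (cderive (frame R i) F)) =
    (- (freq B k 0 i * freq B k 0 i))%:C%C * fcoef B k F.
  rewrite fcoef_derive; [|by []|exact: H1|exact: cderive_periodic].
  rewrite fcoef_derive; [|by []|exact: cdCW|exact: pF].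
  rewrite !dot_frame rmorphN rmorphM /=.
  have ii : 'i%C * 'i%C = -1 :> C.
    by rewrite -expr2 sqr_i.
  transitivity (('i%C * 'i%C) *
    ((freq B k 0 i)%:C%C * (freq B k 0 i)%:C%C) * fcoef B k F).
    by ring.
  by rewrite ii mulN1r.
have : fcoef B k (fun u => \sum_i cderive (frame R i) (cderive (frame R i) F) u) =
    (- lam)%:C%C * fcoef B k F.
  rewrite -fcoefZ; last exact/cdCW/cdCW.
  by apply: (congr1 (fcoef B k)); apply/funext => u; exact: eigF.
rewrite fcoef_sum => [|i]; last exact: cdC_derive (H1 i).
rewrite (eq_bigr _ (fun i _ => Di i)) -mulr_suml -rmorph_sum /= sumrN -dotE.
move=> /eqP; rewrite -subr_eq0 -mulrBl -rmorphB /= mulf_eq0 => /orP[|/eqP //].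
move=> /eqP/(congr1 (@complex.Re R)) /= /eqP.
by rewrite opprK addrC subr_eq0 eq_sym (negbTE kS).
Qed.

Lemma fourier_expansion u : F u = \sum_(k <- S) fcoef B k F * ph k u.
Proof.
pose P u := \sum_(k <- S) fcoef B k F * ph k u.
have HP : cdC 1 P by exact: cdC_phase_sum.
pose G u := F u + (-1) * P u.
have HNP n : cdC n P -> cdC n (fun u => (-1) * P u).
  by move=> h; apply: cdC_mul => //; exact: cdC_cst.
have HG : cdC 1 G by apply: cdC_add; [exact: cdCW|exact: HNP].
have pP : periodic_fun B P.
  move=> l Hl p; apply: eq_bigr => k _.
  by rewrite (phase_periodic unitB k Hl).
have pG : periodic_fun B G by move=> l Hl p; rewrite /G (pF Hl) (pP l Hl).
have fP k : fcoef B k P = fcoef B k F.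
  rewrite fcoef_phase_sum //; case: ifPn => // kS.
  by rewrite fcoef_eigen.
have : G u = 0.
  apply: (fcoef_eq0 unitB HG pG) => k.
  rewrite fcoefD; [|exact/cdCW/cdCW|exact/HNP/cdCW].
  rewrite fcoefZ; last exact: cdCW.
  by rewrite fP mulN1r subrr.
by rewrite /G mulN1r => /eqP; rewrite subr_eq0 => /eqP.
Qed.

End Eigenfunction.
End TrigonometricSums.

(** * Correlations of the Fourier coefficients of a minimal immersion *)

Section HomogeneousImmersion.
Variables (R : realType) (m : nat) (B : 'M[R]_3) (x : 'rV[R]_3 -> 'rV[R]_m.+1).
Hypothesis unitB : B \in unitmx.
Hypothesis immx : isometric_immersion B x.
Hypothesis minx : minimal x.
Variable S : seq 'rV[int]_3.
Hypothesis uniqS : uniq S.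
Hypothesis memS : forall k, (k \in S) = (dot (freq B k) (freq B k) == 3).
Local Notation C := R[i].
Local Notation ph k := (phase (freq B k)).
Implicit Types (k l kap : 'rV[int]_3) (u v w : 'rV[R]_3).

Definition xcoord j : 'rV[R]_3 -> C := to_complex (fun p => x p 0 j).

Definition xcoef k j : C := fcoef B k (xcoord j).

(** The $h(k)$ of the overview. There is no conjugation: it is a term of the convolution that comes
    from the real product $x \cdot x$. *)
Definition corr kap k : C := \sum_j xcoef k j * xcoef (kap - k) j.

Lemma xcoord_cdC n j : cdC n (xcoord j).
Proof. exact/to_complex_cdC/class_C_dC/(immersion_smooth immx). Qed.

Lemma xcoord_periodic j : periodic_fun B (xcoord j).
Proof. exact/to_complex_periodic/coord_periodic. Qed.

Lemma xcoord_eigen j u :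
  \sum_i cderive (frame R i) (cderive (frame R i) (xcoord j)) u =
  (- 3)%:C%C * xcoord j u.
Proof.
have E v : cderive v (cderive v (xcoord j)) u =
    ('D_v ('D_v (fun p => x p 0 j)) u)%:C%C.
  rewrite -[RHS]/(to_complex ('D_v ('D_v (fun p => x p 0 j))) u).
  rewrite -cderive_to_complex; congr (cderive v _ u); apply/funext => q.
  exact: cderive_to_complex.
rewrite (eq_bigr _ (fun i _ => E (frame R i))) -rmorph_sum /=.
by rewrite (laplacian_coord unitB immx minx) rmorphM.
Qed.

Lemma xcoef_eq0 k j : k \notin S -> xcoef k j = 0.
Proof.
exact: (fcoef_eigen unitB (xcoord_cdC 2 j) (xcoord_periodic j) (xcoord_eigen j) memS).
Qed.

Lemma xcoord_expansion j : xcoord j = fun u => \sum_(k <- S) xcoef k j * ph k u.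
Proof.
apply/funext => u; exact: (fourier_expansion unitB (xcoord_cdC 2 j)
  (xcoord_periodic j) (xcoord_eigen j) uniqS memS u).
Qed.

Lemma xcoord_derive v j u : (('D_v x u) 0 j)%:C%C =
  \sum_(k <- S) ('i%C * (dot (freq B k) v)%:C%C * xcoef k j) * ph k u.
Proof.
rewrite -cderive_phase_sum -xcoord_expansion cderive_to_complex /to_complex.
by rewrite derive_coord //; exact: immersion_smooth immx.
Qed.

Lemma corr_sum0 kap : \sum_(k <- S) corr kap k = (kap == 0)%:R.
Proof.
rewrite -[RHS]mul1r -(fcoef_cst unitB) -(fcoef_dot unitB _ _ uniqS).
  apply: (congr1 (fcoef B kap)); apply/funext => u.
  transitivity (\sum_j xcoord j u * xcoord j u).
    by apply: eq_bigr => j _; rewrite xcoord_expansion.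
  rewrite -[1](rmorph1 (real_complex R)) -(immersion_sphere immx u) dotE.
  by rewrite rmorph_sum; apply: eq_bigr => j _; rewrite rmorphM.
by move=> l j; exact: xcoef_eq0.
Qed.

Lemma corr_sum2 kap v w :
  \sum_(k <- S) corr kap k * (dot (freq B k) v * dot (freq B (kap - k)) w)%:C%C
  = - (dot v w)%:C%C * (kap == 0)%:R.
Proof.
rewrite mulNr -(fcoef_cst unitB).
have -> : (fun _ : 'rV[R]_3 => (dot v w)%:C%C) = fun u =>
    \sum_j (\sum_(k <- S) ('i%C * (dot (freq B k) v)%:C%C * xcoef k j) * ph k u) *
           (\sum_(k <- S) ('i%C * (dot (freq B k) w)%:C%C * xcoef k j) * ph k u).
  apply/funext => u; rewrite -(immersion_isometric immx u v w) dotE rmorph_sum.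
  apply: eq_bigr => j _; rewrite rmorphM /=.
  by congr (_ * _); exact: xcoord_derive.
rewrite (fcoef_dot unitB (fun k j => 'i%C * (dot (freq B k) v)%:C%C * xcoef k j)
  (q := fun k j => 'i%C * (dot (freq B k) w)%:C%C * xcoef k j)) //; last first.
  by move=> l j /(xcoef_eq0 j) ->; rewrite mulr0.
rewrite -sumrN; apply: eq_bigr => k _.
rewrite /corr mulr_suml -sumrN; apply: eq_bigr => j _.
have ii : 'i%C * 'i%C = -1 :> C.
  by rewrite -expr2 sqr_i.
rewrite rmorphM /=.
move: (xcoef k j) (xcoef (kap - k) j) => a b.
move: ((dot (freq B k) v)%:C%C) ((dot _ w)%:C%C) => c d.
transitivity (- (('i%C * 'i%C) * (c * d * a * b))); last by ring.
by rewrite ii; ring.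
Qed.

Lemma corr_support kap k : corr kap k != 0 -> k \in S.
Proof.
apply: contraNT => kS; apply/eqP; rewrite /corr big1 // => j _.
by rewrite xcoef_eq0 // mul0r.
Qed.

Lemma corr_sym kap k : corr kap (kap - k) = corr kap k.
Proof.
rewrite /corr; apply: eq_bigr => j _.
by rewrite subKr; exact: mulrC.
Qed.

(** For [kap = 0], [corr_sum2] says that the $\eta_k^T\eta_k$ weighted by [corr 0 k] sum to the
    identity, as $\eta_{-k} = -\eta_k$. Pairing with the form gives its trace as a combination of
    its values at the [freq B k], all zero. *)
Lemma trace_pullback_eq0 X :
  (forall k, k \in S -> (map_mx intr k *m X *m (map_mx intr k)^T) 0 0 = 0) ->
  \tr (pullback B X) = 0.
Proof.
move=> HX; set M := pullback B X.
have MS k : k \in S -> bform M (freq B k) (freq B k) = 0.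
  by move=> kS; rewrite pullback_freq // HX // rmorph0.
have T a b : \sum_(k <- S) corr 0 k * (freq B k 0 a * freq B k 0 b)%:C%C = (a == b)%:R.
  have := corr_sum2 0 (frame R a) (frame R b).
  rewrite eqxx mulr1 dot_frame /frame mxE /= eq_sym => H.
  rewrite -[RHS]opprK -[in RHS](rmorph_nat (real_complex R)) -H -sumrN.
  apply: eq_bigr => k _; rewrite -!/(frame R _) !dot_frame sub0r freqN.
  rewrite [(- freq B k) 0 b](_ : _ = - freq B k 0 b); last by rewrite [LHS]mxE.
  by rewrite mulrN rmorphN /= mulrN opprK.
have E : (\tr M)%:C%C = \sum_(k <- S) corr 0 k * (bform M (freq B k) (freq B k))%:C%C.
  transitivity (\sum_a \sum_b (M a b)%:C%C * (a == b)%:R : C).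
    rewrite /mxtrace rmorph_sum; apply: eq_bigr => a _.
    rewrite (bigD1 a) //= eqxx mulr1 big1 ?addr0 // => b.
    by rewrite eq_sym => /negbTE ->; rewrite mulr0.
  under eq_bigr => a _ do under eq_bigr => b _ do rewrite -T mulr_sumr.
  under eq_bigr => a _ do rewrite exchange_big.
  rewrite exchange_big; apply: eq_bigr => k _.
  have sumC (G : 'I_3 -> R) : (\sum_i G i)%:C%C = \sum_i (G i)%:C%C :> C.
    exact: (rmorph_sum (real_complex R)).
  rewrite bform_sum sumC mulr_sumr /=; apply: eq_bigr => a _.
  rewrite sumC mulr_sumr; apply: eq_bigr => b _.
  by rewrite !rmorphM /=; ring.
have : (\tr M)%:C%C = 0.
  by rewrite E big_seq big1 // => k kS; rewrite MS // rmorph0 mulr0.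
by move=> /(congr1 (@complex.Re R)).
Qed.

Lemma corr_eq0 kap k : irrational_torus B -> kap != 0 -> corr kap k = 0.
Proof.
move=> irrB kap0; apply/eqP; apply: contrapT => /negP hk.
have irr := dual_gram_irrational unitB irrB.
have HS l : l \in S -> dot (freq B l) (freq B l) = 3 by rewrite memS => /eqP.
have [X [Xs X0 XS]] := rational_cone irr HS.
have Ms : (pullback B X)^T = pullback B X.
  by rewrite /pullback linearZ /= !trmx_mul trmxK mulmxA map_trmx Xs.
have := @rigid_form R _ (freq B) (@freqD R B) (freq_inj unitB) S (corr kap) kap
  (pullback B X) uniqS kap0 (@corr_support kap) _ (corr_sym kap) _ _ Ms
  (pullback_neq0 unitB X0) (trace_pullback_eq0 XS) _
  (fun l => freq B l - 2^-1 *: freq B kap) (fun=> erefl) k hk.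
case.
- by move=> l /corr_support/HS.
- by rewrite corr_sum0 (negbTE kap0).
- by move=> w; rewrite corr_sum2 (negbTE kap0) mulr0.
- by move=> l /corr_support lS; rewrite pullback_freq // XS // rmorph0.
move=> om4 [t t0 E].
have [Y YE] := rigid_form_rational unitB t0 om4 E.
exact: irr YE.
Qed.

(** In the double Fourier expansion of the inner product only the terms with [k + l = 0] survive,
    and for these the two phases contributed by [v] cancel. *)
Lemma gram_translation_invariant u u' v : irrational_torus B ->
  dot (x (u + v)) (x (u' + v)) = dot (x u) (x u').
Proof.
move=> irrB.
have K p p' : (dot (x p) (x p'))%:C%C =
    \sum_(k <- S) \sum_(l <- S) corr (k + l) k * (ph k p * ph l p').
  rewrite dotE rmorph_sum.
  transitivity (\sum_j \sum_(k <- S) \sum_(l <- S)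
      (xcoef k j * xcoef l j) * (ph k p * ph l p')).
    apply: eq_bigr => j _; rewrite rmorphM /=.
    rewrite -[(x p 0 j)%:C%C]/(xcoord j p) -[(x p' 0 j)%:C%C]/(xcoord j p').
    rewrite xcoord_expansion mulr_suml; apply: eq_bigr => k _.
    by rewrite mulr_sumr; apply: eq_bigr => l _; exact: mulrACA.
  rewrite exchange_big; apply: eq_bigr => k _.
  rewrite exchange_big; apply: eq_bigr => l _.
  by rewrite /corr addrC addKr mulr_suml.
have : (dot (x (u + v)) (x (u' + v)))%:C%C = (dot (x u) (x u'))%:C%C.
  rewrite !K; apply: eq_bigr => k _; apply: eq_bigr => l _.
  have [kl|kl] := eqVneq (k + l) 0; last by rewrite corr_eq0 ?mul0r.
  congr (_ * _); rewrite !phase_shift mulrACA -[X in _ * X]phaseD -freqD kl.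
  by rewrite freq0 phase0l mulr1.
by move=> /(congr1 (@complex.Re R)).
Qed.

End HomogeneousImmersion.

Theorem theorem4p9 (R : realType) (m : nat) (B : 'M[R]_3)
    (x : 'rV[R]_3 -> 'rV[R]_m.+1) :
  B \in unitmx ->
  irrational_torus B ->
  isometric_immersion B x ->
  minimal x ->
  homogeneous x.
Proof.
move=> unitB irrB immx minx v.
have [S uS mS] := freq_sphere_finite unitB 3.
have [s t|g gg xg] := @orthogonal_extension R m.+1 _ x (fun u => x (u + v)).
  by rewrite (gram_translation_invariant unitB immx minx uS mS).
by exists g.
Qed.
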